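(* Let $\Omega$ be an $R$-domain of degree $\ge2$. Then the matching problem for $\Gamma=\partial\Omega$ has only trivial solutions, i.e. if $(f,g)$ is a solution then $f$ and $g$ are constant (hence $f\equiv0$, $g\equiv0$).
   Context: An $R$-domain is a simply connected plane domain $\Omega=\varphi(\mathbb D)$, where $\mathbb D$ is the open unit disk and $\varphi$ is a rational function univalent on a neighborhood of $\overline{\mathbb D}$; its degree is the degree of $\varphi=p/q$ ($p,q$ coprime polynomials), namely $\max(\deg p,\deg q)$. For a Jordan curve $\Gamma$ with interior domain $\Omega$ and exterior domain $\Omega':=\widehat{\mathbb C}\setminus\overline\Omega$, a solution of the matching problem is a pair $(f,g)$ with: $f$ holomorphic in $\Omega$ and continuous on $\overline\Omega$; $g$ holomorphic in $\Omega'$, continuous on $\overline{\Omega'}$, with $g(\infty)=0$; and $f(\zeta)=\overline{g(\zeta)}$ for all $\zeta\in\Gamma$. It is non-trivial if $f,g$ are non-constant. *)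

(* Defs.v *)
(* The complex plane is R[i] = complex R
   for R : realType (realType is real closed), equipped with its canonical
   normed-field topology (numFieldNormedType).  Complex differentiability is
   MathComp-Analysis [derivable f z 1] where the scalar field is C itself. *)
From HB Require Import structures.
From mathcomp Require Import all_boot all_order all_algebra.
From mathcomp Require Import all_classical all_reals all_analysis.
From mathcomp.real_closed Require Import complex.
Set Implicit Arguments. Unset Strict Implicit. Unset Printing Implicit Defensive.
Import Order.TTheory GRing.Theory Num.Theory.
Import numFieldNormedType.Exports numFieldTopology.Exports.
Local Open Scope classical_set_scope.
Local Open Scope ring_scope.

(* the complex plane over R, with its numClosedFieldType structure so that the
   canonical topology / normed structure of MathComp-Analysis applies *)
Definition Cplx (R : realType) : numClosedFieldType := R[i].

Section Defs.
Variable R : realType.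
Local Notation C := (Cplx R).

Definition unit_disk : set C := [set z | `|z| < 1].
Definition unit_circle : set C := [set z | `|z| = 1].
Definition closed_unit_disk : set C := [set z | `|z| <= 1].

Definition ratfun (p q : {poly C}) : C -> C := fun z => p.[z] / q.[z].

(* degree of p/q (p, q coprime): max(deg p, deg q) *)
Definition ratfun_degree (p q : {poly C}) : nat := maxn (size p).-1 (size q).-1.

(* p/q (p, q coprime, q <> 0) is univalent (holomorphic and injective) on a
   neighbourhood of the closed unit disk; the image of the disk is a plane
   domain, so no pole lies on a neighbourhood of the closed disk. *)
Definition R_domain_data (p q : {poly C}) : Prop :=
  [/\ q != 0, coprimep p q &
      exists U : set C, [/\ open U, closed_unit_disk `<=` U,
        (forall z, U z -> q.[z] != 0) & ({in U &, injective (ratfun p q)})]].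

Definition holomorphic_on (f : C -> C) (A : set C) : Prop :=
  forall z, A z -> derivable f z 1.

(* g extends holomorphically to infinity with g(oo) = 0:
   w |-> g(1/w), extended by 0 at w = 0, is complex differentiable at 0 *)
Definition holo_at_infty_zero (g : C -> C) : Prop :=
  derivable (fun w : C => if w == 0 then 0 else g w^-1) 0 1.

(* solution (f,g) of the matching problem for the Jordan curve
   Gamma = boundary of Omega (interior domain Omega);
   the plane part of the exterior domain is ~` closure Omega *)
Definition matching_solution (Omega Gamma : set C) (f g : C -> C) : Prop :=
  [/\ holomorphic_on f Omega /\ {within closure Omega, continuous f},
      holomorphic_on g (~` closure Omega),
      {within closure (~` closure Omega), continuous g},
      holo_at_infty_zero g &
      forall zeta, Gamma zeta -> f zeta = Num.conj (g zeta)].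

End Defs.

(* Main.v *)
(* Choose [w0 = phi a] in Omega with [phi' a <> 0] and pass to the coordinates
   [chi u = 1 / (phi (1 / u) - w0)] and [k v = g (w0 + 1 / v)]: then [k] is
   holomorphic on a bounded open set [V], and
   [F u = conj (f (phi (conj u)))], holomorphic in the unit disk, satisfies
   [F = k o chi] on the unit circle.  By uniqueness [F = k o chi] in an inner
   collar of the circle, hence on the whole part of [chi^-1 V] attached to it.
   Since [phi] has degree at least 2, the rational function [chi] has a pole in
   the disk, so this part has boundary points inside the disk; an open-closed
   argument along the collar shows that it covers, away from the circle, every
   value taken by [chi] on the collar.  Consequently the maximum of [|F|], which
   is attained on the circle, is also attained inside the disk: [F] is constant,
   therefore so is [k], and [k 0 = g oo = 0].

   The only complex analysis needed is the maximum principle, obtained from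
   Goursat's theorem on rectangles applied to [F (c + exp z)], which yields the
   mean value property. *)
Require Import Defs.
From HB Require Import structures.
From mathcomp Require Import all_boot all_order all_algebra.
From mathcomp Require Import all_classical all_reals all_analysis.
From mathcomp.real_closed Require Import complex.
From mathcomp Require Import ring lra.
Import Order.TTheory GRing.Theory Num.Theory.
Import numFieldNormedType.Exports numFieldTopology.Exports.
Local Open Scope classical_set_scope.
Local Open Scope ring_scope.
Set Implicit Arguments.
Unset Strict Implicit.
Unset Printing Implicit Defensive.

(** On the unit circle [conj u = 1 / u]; this is why the disk variable is inverted: the boundary
    relation [f = conj g] then turns into an equality between the holomorphic functions [F] and
    [k o chi]. The obstacle is that [F] lives on the whole disk, while [k (chi u)] makes sense only
    where [chi u] lies in [V]. The collar comes from the univalence of [phi] slightly beyond the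
    closed disk, which makes [chi] injective near the circle. The degree gives a second preimage:
    counted on the sphere with multiplicity, [phi z = w0] has at least two solutions; [a] is simple
    because [phi' a <> 0], and it is the only one in the closed disk, so another lies outside,
    possibly at infinity, and its inverse is the pole of [chi]. On the way from the collar to this
    pole [chi] leaves [V], at a point whose value is also taken on the circle. From there on, collar
    values are attained twice, and the radius [(1 + rho) / 2] keeps the two preimages apart. *)

(** * Real-valued modulus, and epsilon-delta forms of topology and derivability *)

Section ComplexModulus.
Variable R : realType.
Local Notation C := (Cplx R).
Implicit Types (z w : C) (f g : C -> C).

(** The norm of [C] takes its values in [C], which is not totally ordered; a modulus in [R] allows
    [lra] and [nra]. *)
Definition cmod (z : C) : R := ComplexField.Normc.normc (z : R[i]).
Definition cR (x : R) : C := (x%:C)%C.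
Definition mkC (x y : R) : C := (x +i* y)%C.

Lemma normE z : `|z| = cR (cmod z).
Proof. by []. Qed.

Lemma le_cR x y : (cR x <= cR y) = (x <= y).
Proof. exact: lecR. Qed.
Lemma lt_cR x y : (cR x < cR y) = (x < y).
Proof. exact: ltcR. Qed.
Lemma cRD x y : cR (x + y) = cR x + cR y.
Proof. exact: rmorphD. Qed.
Lemma cRM x y : cR (x * y) = cR x * cR y.
Proof. exact: rmorphM. Qed.
Lemma cRN x : cR (- x) = - cR x.
Proof. exact: rmorphN. Qed.
Lemma cR0 : cR 0 = 0. Proof. by []. Qed.
Lemma cR1 : cR 1 = 1. Proof. by []. Qed.

Lemma cR_inj x y : cR x = cR y -> x = y. Proof. by case. Qed.

Lemma cmod_ge0 z : 0 <= cmod z.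
Proof. by rewrite -le_cR -normE cR0. Qed.
Lemma cmod0 : cmod 0 = 0.
Proof. by apply: cR_inj; rewrite -normE normr0. Qed.
Lemma cmod1 : cmod 1 = 1.
Proof. by apply: cR_inj; rewrite -normE normr1. Qed.
Lemma cmod_eq0 z : (cmod z == 0) = (z == 0).
Proof. 
apply/eqP/eqP=> [H|->]; last exact: cmod0.
by apply/normr0_eq0; rewrite normE H.
Qed.
Lemma cmod_gt0 z : (0 < cmod z) = (z != 0).
Proof. by rewrite lt_def cmod_ge0 andbT cmod_eq0. Qed.
Lemma cmodM z w : cmod (z * w) = cmod z * cmod w.
Proof. by apply: cR_inj; rewrite cRM -!normE normrM. Qed.
Lemma cmodX z n : cmod (z ^+ n) = cmod z ^+ n.
Proof. by elim: n => [|n IH]; rewrite ?expr0 ?cmod1// !exprS cmodM IH. Qed.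
Lemma cmodN z : cmod (- z) = cmod z.
Proof. by apply: cR_inj; rewrite -!normE normrN. Qed.
Lemma cmodB z w : cmod (z - w) = cmod (w - z).
Proof. by rewrite -cmodN opprB. Qed.
Lemma cmodD z w : cmod (z + w) <= cmod z + cmod w.
Proof. by rewrite -le_cR cRD -!normE ler_normD. Qed.
Lemma cmod_tri z w v : cmod (z - w) <= cmod (z - v) + cmod (v - w).
Proof. by apply: le_trans (cmodD _ _); rewrite addrA subrK. Qed.
Lemma cmod_rtri z w : cmod z <= cmod (z - w) + cmod w.
Proof. by apply: le_trans (cmodD _ _); rewrite subrK. Qed.
Lemma cmodV z : cmod z^-1 = (cmod z)^-1.
Proof. exact: ComplexField.Normc.normcV. Qed.
Lemma cmod_conj z : cmod (Num.conj z) = cmod z.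
Proof. by apply: cR_inj; rewrite -!normE norm_conjC. Qed.
Lemma cmod_cR x : cmod (cR x) = `|x|.
Proof. by rewrite /cmod /= expr0n /= addr0 sqrtr_sqr. Qed.

Definition reC (z : C) : R := complex.Re z.
Definition imC (z : C) : R := complex.Im z.

Lemma mkC_eta z : z = mkC (reC z) (imC z). Proof. by case: z. Qed.
Lemma reC_mk x y : reC (mkC x y) = x. Proof. by []. Qed.
Lemma imC_mk x y : imC (mkC x y) = y. Proof. by []. Qed.
Lemma mkCE x y : mkC x y = cR x + mkC 0 1 * cR y.
Proof. exact: (complexE (x +i* y)%C). Qed.
Lemma mkCM x y x' y' : mkC x y * mkC x' y' = mkC (x * x' - y * y') (x * y' + y * x').
Proof. by []. Qed.
Lemma reCD z w : reC (z + w) = reC z + reC w. Proof. by case: z; case: w. Qed.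
Lemma imCD z w : imC (z + w) = imC z + imC w. Proof. by case: z; case: w. Qed.
Lemma reCN z : reC (- z) = - reC z. Proof. by case: z. Qed.
Lemma imCN z : imC (- z) = - imC z. Proof. by case: z. Qed.
Lemma reCM z w : reC (z * w) = reC z * reC w - imC z * imC w.
Proof. by case: z; case: w. Qed.
Lemma imCM z w : imC (z * w) = reC z * imC w + imC z * reC w.
Proof. by case: z; case: w. Qed.

Lemma cmod_sqr z : cmod z ^+ 2 = reC z ^+ 2 + imC z ^+ 2.
Proof.
rewrite /cmod; case: z => a b /=; rewrite sqr_sqrtr //.
by rewrite addr_ge0 // sqr_ge0.
Qed.
Lemma re_le z : `|reC z| <= cmod z.
Proof.
rewrite -(@ler_pXn2r _ 2) ?nnegrE ?cmod_ge0 // cmod_sqr real_normK ?num_real //.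
by rewrite lerDl sqr_ge0.
Qed.
Lemma im_le z : `|imC z| <= cmod z.
Proof.
rewrite -(@ler_pXn2r _ 2) ?nnegrE ?cmod_ge0 // cmod_sqr real_normK ?num_real //.
by rewrite lerDr sqr_ge0.
Qed.
Lemma cmod_le z : cmod z <= `|reC z| + `|imC z|.
Proof.
rewrite -(@ler_pXn2r _ 2) ?nnegrE ?cmod_ge0 ?addr_ge0 // cmod_sqr sqrrD.
rewrite !real_normK ?num_real //.
have : 0 <= `|reC z| * `|imC z| by rewrite mulr_ge0.
by move=> ?; rewrite mulr2n; lra.
Qed.

(** Radii of balls in [C] are positive elements of [C], hence real; they are exchanged here for
    radii in [R]. *)
Lemma nbhsCP z (P : set C) :
  nbhs z P <-> exists2 e : R, 0 < e & forall w, cmod (w - z) < e -> P w.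
Proof.
split.
  move=> /nbhs_ballP[e /= e0 H].
  have re : e \is Num.real by apply: gtr0_real.
  have ee : e = cR (complex.Re (e : R[i])) by rewrite /cR RRe_real.
  exists (complex.Re (e : R[i])); first by rewrite -lt_cR -ee.
  move=> w hw; apply: H; rewrite /ball /= ee.
  by rewrite normE lt_cR cmodB.
move=> [e e0 H]; apply/nbhs_ballP; exists (cR e); first by rewrite /= -cR0 lt_cR.
by move=> w; rewrite /ball /= normE lt_cR cmodB; apply: H.
Qed.

Lemma openCP (A : set C) : open A <->
  forall z, A z -> exists2 e : R, 0 < e & forall w, cmod (w - z) < e -> A w.
Proof.
rewrite openE; split=> H z /H; first by move/nbhsCP.
by move=> ?; apply/nbhsCP.
Qed.

Lemma closureCP (A : set C) z :
  closure A z <-> forall e : R, 0 < e -> exists2 w, A w & cmod (w - z) < e.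
Proof.
split.
  move=> H e e0; have /H [w [Aw hw]] : nbhs z [set w | cmod (w - z) < e].
    by apply/nbhsCP; exists e.
  by exists w.
move=> H B /nbhsCP[e e0 HB]; have [w Aw hw] := H e e0.
by exists w; split => //; apply: HB.
Qed.

Definition ccont (K : set C) f z :=
  forall e : R, 0 < e -> exists2 d : R, 0 < d &
    forall w, K w -> cmod (w - z) < d -> cmod (f w - f z) < e.

Lemma within_ccont (K : set C) f : {within K, continuous f} ->
  forall z, K z -> ccont K f z.
Proof.
move=> /subspace_continuousP H z Kz e e0.
have : nbhs (f z) [set v | cmod (v - f z) < e] by apply/nbhsCP; exists e.
move=> /(H z Kz); rewrite nbhs_filterE /= /fmap /within /=.
by move=> /nbhsCP [d d0 Hd]; exists d => // w Kw hw; apply: Hd.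
Qed.

(** The increment form contains no quotient, so [h = 0] needs no exception in later estimates. *)
Lemma derivableCP f z : derivable f z 1 <->
  exists d : C, forall e : R, 0 < e -> exists2 r : R, 0 < r &
    forall h, cmod h < r -> cmod (f (z + h) - f z - d * h) <= e * cmod h.
Proof.
split.
  move=> /cvg_ex[d Hd]; exists d => e e0.
  have : nbhs (d : C) [set v : C | cmod (v - d) < e] by apply/nbhsCP; exists e.
  move=> /Hd; rewrite nbhs_filterE /= /fmap /dnbhs /within /=.
  move=> /nbhsCP[r r0 Hr]; exists r => // h hr.
  have [->|h0] := eqVneq h 0.
    by rewrite addr0 subrr mulr0 subr0 cmod0 mulr0.
  have /Hr /(_ h0) : cmod (h - 0) < r by rewrite subr0.
  rewrite /= -[h *: 1]/(h * 1) mulr1 => H.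
  have -> : f (z + h) - f z - d * h = ((h^-1 *: (f (h + z) - f z)) - d) * h.
    rewrite -[h^-1 *: _]/(h^-1 * _) mulrBl [h + z]addrC.
    by rewrite mulrAC mulVf // mul1r.
  by rewrite cmodM ler_wpM2r ?cmod_ge0 // ltW.
move=> [d H]; apply/cvg_ex; exists d => P /nbhsCP [e e0 HP].
have e2 : 0 < e / 2 by rewrite divr_gt0.
have [r r0 Hr] := H (e / 2) e2.
rewrite nbhs_filterE /= /fmap /dnbhs /within /=.
apply/nbhsCP; exists r => // h; rewrite subr0 => hr h0; apply: HP.
rewrite /= -[h *: 1]/(h * 1) mulr1.
have := Hr h hr.
have -> : f (z + h) - f z - d * h = ((h^-1 *: (f (h + z) - f z)) - d) * h.
  rewrite -[h^-1 *: _]/(h^-1 * _) mulrBl [h + z]addrC.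
  by rewrite mulrAC mulVf // mul1r.
rewrite cmodM ler_pM2r ?cmod_gt0 // => /le_lt_trans; apply; lra.
Qed.

Lemma derivable_ccont K f z : derivable f z 1 -> ccont K f z.
Proof.
move=> /derivableCP[d Hd] e e0.
have [r r0 Hr] := Hd 1 ltr01.
have p0 : 0 < 1 + cmod d by have := cmod_ge0 d; lra.
exists (Num.min r (e / (1 + cmod d))); first by rewrite lt_min r0 divr_gt0.
move=> w _; rewrite lt_min ltr_pdivlMr // => /andP[h1 h2].
have := Hr _ h1; rewrite addrCA subrr addr0 => h3.
have := cmod_rtri (f w - f z) (d * (w - z)); rewrite cmodM => h4.
nra.
Qed.

(** Stated with a cluster point rather than a subsequence: terms of arbitrarily large index close to
    [z] are all that is needed later. *)
Lemma bolzano_weierstrassC (u : nat -> C) (M : R) : (forall n, cmod (u n) <= M) ->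
  exists z, forall (e : R), 0 < e -> forall N : nat, exists2 n, (N <= n)%N & cmod (u n - z) < e.
Proof.
move=> uM.
have cK : compact (`[- M, M]%classic `*` `[- M, M]%classic : set (R * R)).
  by apply: compact_setX; exact: segment_compact.
pose v n := (reC (u n), imC (u n)).
have inK : (v @ \oo) (`[- M, M]%classic `*` `[- M, M]%classic : set (R * R)).
  exists 0%N => // n _; rewrite /v; split => /=; rewrite in_itv /= -ler_norml.
    exact: le_trans (re_le _) (uM n).
  exact: le_trans (im_le _) (uM n).
have [[a b] [_ cl]] := cK (v @ \oo) _ inK.
exists (mkC a b) => e e0 N.
have e2 : 0 < e / 2 by rewrite divr_gt0.
have [||p []] := cl (v @` [set n | (N <= n)%N]) (ball a (e/2) `*` ball b (e/2)).
- by exists N => // n Nn; exists n.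
- exists (ball a (e/2), ball b (e/2)) => //=; split; exact: nbhsx_ballx.
move=> [n Nn <-] [/= h1 h2]; exists n => //.
apply: le_lt_trans (cmod_le _) _; rewrite reCD imCD reCN imCN reC_mk imC_mk.
by rewrite /ball /= in h1 h2; rewrite distrC in h1; rewrite distrC in h2; lra.
Qed.

End ComplexModulus.

Arguments cmod {R} z : simpl never.

(** * Real analysis: nested intervals, primitives and the mean value theorem *)

Section RealFacts.
Variable R : realType.

Lemma expr_small (q e : R) : 0 <= q < 1 -> 0 < e -> exists n : nat, q ^+ n < e.
Proof.
move=> /andP[q0 q1] e0.
have /cvgrPdist_lt /(_ e e0) [N _ HN] : q ^+ n @[n --> \oo] --> (0 : R).
  by apply: cvg_expr; rewrite ger0_norm.
exists N; have := HN N (leqnn N).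
by rewrite /= sub0r normrN ger0_norm // exprn_ge0.
Qed.

Lemma nested_intervals (x l : nat -> R) : (forall n, 0 <= l n) ->
  (forall n, x n <= x n.+1) -> (forall n, x n.+1 + l n.+1 <= x n + l n) ->
  exists t, forall n, x n <= t <= x n + l n.
Proof.
move=> l0 xi yd.
have mx m n : (m <= n)%N -> x m <= x n.
  elim: n => [|n IH]; first by rewrite leqn0 => /eqP ->.
  by rewrite leq_eqVlt => /orP[/eqP ->//|/IH h]; apply: le_trans h (xi n).
have my m n : (m <= n)%N -> x n + l n <= x m + l m.
  elim: n => [|n IH]; first by rewrite leqn0 => /eqP ->.
  by rewrite leq_eqVlt => /orP[/eqP ->//|/IH h]; apply: le_trans (yd n) h.
have ub n : ubound (range x) (x n + l n).
  move=> _ [m _ <-]; have [mn|/ltnW nm] := leqP m n.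
    by have := mx _ _ mn; have := l0 n; lra.
  by have := my _ _ nm; have := l0 m; lra.
have hs : has_sup (range x) by split; [exists (x 0%N); exists 0%N|exists (x 0%N + l 0%N)].
exists (sup (range x)) => n; apply/andP; split.
  by apply: ub_le_sup; [case: hs|exists n].
by apply: ge_sup => //; case: hs.
Qed.

Lemma antiderivative (a b : R) (u : R -> R) : a < b ->
  (forall x, a <= x <= b -> {for x, continuous u}) ->
  forall x, a < x < b -> is_derive x 1 (fun y => \int[lebesgue_measure]_(t in `[a, y]) u t)%R (u x).
Proof.
move=> ab cu x /andP[ax xb].
have [||d1 d2] := @continuous_FTC1_closed R u a x b xb _ ax.
- apply: continuous_compact_integrable; first exact: segment_compact.
  apply: continuous_in_subspaceT => y; rewrite inE /= in_itv /=; exact: cu.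
- by apply: cu; rewrite !ltW.
split; first exact: d1.
rewrite -derive1E; exact: d2.
Qed.

Lemma is_derive_cont (U : R -> R) (x d : R) : is_derive x 1 U d -> {for x, continuous U}.
Proof. by case=> h _; apply/differentiable_continuous/derivable1_diffP. Qed.

(** The mean value theorem, applied to [U] minus a primitive of [A + B * x], takes the place of an
    estimate of integrals. *)
Lemma MVT_bound (U u : R -> R) (a b A B M : R) : a <= b ->
  (forall x, a <= x <= b -> is_derive x 1 U (u x)) ->
  (forall x, a <= x <= b -> `|u x - (A + B * x)| <= M) ->
  `|U b - U a - (A * (b - a) + B * (b ^+ 2 - a ^+ 2) / 2)| <= M * (b - a).
Proof.
move=> ab dU hM.
pose V := U - (cst A * id + cst (B / 2) * id ^+ 2 : R -> R).
have dV x : a <= x <= b -> is_derive x 1 V (u x - (A + B * x)).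
  move=> /dU h; apply: is_derive_eq.
  rewrite /= /GRing.scale /= /cst; lra.
have [||c] := @MVT_segment R V (fun x => u x - (A + B * x)) a b ab.
- by move=> x /[!in_itv]/= /andP[h1 h2]; apply: dV; rewrite !ltW.
- apply: continuous_in_subspaceT => x; rewrite inE /= in_itv /= => /dV.
  exact: is_derive_cont.
move=> /[!in_itv]/= cab.
have -> : V b - V a = U b - U a - (A * (b - a) + B * (b ^+ 2 - a ^+ 2) / 2).
  by rewrite /V !fctE; field.
by move=> ->; rewrite normrM [`|b - a|]ger0_norm ?subr_ge0 // ler_wpM2r ?subr_ge0 // hM.
Qed.
End RealFacts.

(** * Integrals along the sides of a rectangle *)

Section Goursat.
Variable R : realType.
Local Notation C := (Cplx R).

Definition rcont (u : R -> C) (x : R) :=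
  forall e : R, 0 < e -> exists2 d : R, 0 < d & forall y, `|y - x| < d -> cmod (u y - u x) < e.

Lemma rcont_re u x : rcont u x -> {for x, continuous (@reC R \o u)}.
Proof.
move=> H; apply/cvgrPdist_lt => e /H [d d0 Hd].
exists d => //= y; rewrite /ball /= distrC => /Hd h.
by rewrite distrC; apply: le_lt_trans h; rewrite -reCN -reCD; exact: re_le.
Qed.

Lemma rcont_im u x : rcont u x -> {for x, continuous (@imC R \o u)}.
Proof.
move=> H; apply/cvgrPdist_lt => e /H [d d0 Hd].
exists d => //= y; rewrite /ball /= distrC => /Hd h.
by rewrite distrC; apply: le_lt_trans h; rewrite -imCN -imCD; exact: im_le.
Qed.

(** Only differences of [prim] matter: they are the integrals between two points. The base point is
    kept strictly to the left of both, where the fundamental theorem gives a two-sided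
    derivative. *)
Definition prim (a : R) (u : R -> C) (x : R) : C :=
  mkC (\int[lebesgue_measure]_(t in `[a, x]) (@reC R \o u) t)%R
      (\int[lebesgue_measure]_(t in `[a, x]) (@imC R \o u) t)%R.

Lemma prim_re (a b : R) u x : (forall x, a <= x <= b -> rcont u x) ->
  a < x < b -> is_derive x 1 (@reC R \o prim a u) (reC (u x)).
Proof.
move=> H ab; apply: (@antiderivative R a b (@reC R \o u)) => //.
  by case/andP: ab; apply: lt_trans.
by move=> y /H /rcont_re.
Qed.

Lemma prim_im (a b : R) u x : (forall x, a <= x <= b -> rcont u x) ->
  a < x < b -> is_derive x 1 (@imC R \o prim a u) (imC (u x)).
Proof.
move=> H ab; apply: (@antiderivative R a b (@imC R \o u)) => //.
  by case/andP: ab; apply: lt_trans.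
by move=> y /H /rcont_im.
Qed.

(** The factor 2 comes from adding the bounds for the real and imaginary parts. *)
Lemma prim_bound (a0 b0 : R) u (a b : R) (A B : C) (M : R) :
  (forall x, a0 <= x <= b0 -> rcont u x) -> a0 < a -> a <= b -> b < b0 ->
  (forall x, a <= x <= b -> cmod (u x - (A + B * cR x)) <= M) ->
  cmod (prim a0 u b - prim a0 u a - (A * cR (b - a) + B * cR ((b ^+ 2 - a ^+ 2) / 2)))
    <= 2 * M * (b - a).
Proof.
move=> cu a0a ab bb0 hM.
have inab x : a <= x <= b -> a0 < x < b0.
  by move=> /andP[h1 h2]; apply/andP; split; lra.
have rB (D : C) x : reC (D * cR x) = reC D * x.
  by rewrite reCM [reC (cR x)]/= [imC (cR x)]/= mulr0 subr0.
have iB (D : C) x : imC (D * cR x) = imC D * x.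
  by rewrite imCM [reC (cR x)]/= [imC (cR x)]/= mulr0 add0r.
have h1 := @MVT_bound R (@reC R \o prim a0 u) (@reC R \o u) a b (reC A) (reC B) M ab
  (fun x h => prim_re cu (inab x h)).
have h2 := @MVT_bound R (@imC R \o prim a0 u) (@imC R \o u) a b (imC A) (imC B) M ab
  (fun x h => prim_im cu (inab x h)).
apply: le_trans (cmod_le _) _.
rewrite !(reCD, imCD, reCN, imCN) !rB !iB.
have -> : 2 * M * (b - a) = M * (b - a) + M * (b - a) by ring.
rewrite !mulrA; apply: lerD.
  apply: h1 => x /hM; apply: le_trans; apply: le_trans (re_le _).
  by rewrite !(reCD, reCN) rB.
apply: h2 => x /hM; apply: le_trans; apply: le_trans (im_le _).
by rewrite !(imCD, imCN) iB.
Qed.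

Section Rectangle.
Variables (H : C -> C) (a b c d : R).
Hypothesis dH : forall x y, a <= x <= b -> c <= y <= d -> derivable H (mkC x y) 1.

Let X (y : R) : R -> C := prim a (fun x => H (mkC x y)).
Let Y (x : R) : R -> C := prim c (fun y => H (mkC x y)).
Let ii : C := mkC 0 1.

(** The anticlockwise contour integral of [H]: bottom, right, top and left sides, with [dz = i dy]
    on the vertical ones. *)
Definition boundary_int (x0 x1 y0 y1 : R) : C :=
  (X y0 x1 - X y0 x0) + ii * (Y x1 y1 - Y x1 y0)
  - (X y1 x1 - X y1 x0) - ii * (Y x0 y1 - Y x0 y0).

Lemma horizontal_rcont x y : a <= x <= b -> c <= y <= d -> rcont (fun x => H (mkC x y)) x.
Proof.
move=> hx hy e e0; have [r r0 Hr] := derivable_ccont setT (dH hx hy) e0.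
exists r => // x' hx'; apply: Hr => //.
have -> : mkC x' y - mkC x y = cR (x' - x).
  by rewrite [LHS]mkC_eta !(reCD, imCD, reCN, imCN) !reC_mk !imC_mk subrr.
by rewrite cmod_cR.
Qed.

Lemma cmod_ii : cmod ii = 1.
Proof. by rewrite /cmod /ComplexField.Normc.normc /= expr0n /= add0r expr1n sqrtr1. Qed.

Lemma vertical_rcont x y : a <= x <= b -> c <= y <= d -> rcont (fun y => H (mkC x y)) y.
Proof.
move=> hx hy e e0; have [r r0 Hr] := derivable_ccont setT (dH hx hy) e0.
exists r => // y' hy'; apply: Hr => //.
have -> : mkC x y' - mkC x y = ii * cR (y' - y).
  by rewrite (mkCE x y') (mkCE x y) cRD cRN /ii; ring.
by rewrite cmodM cmod_ii mul1r cmod_cR.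
Qed.

(** The affine approximation [G + D * z] of [H] integrates to zero around the rectangle. What
    remains is an error of at most [e * s] on sides of total length [2 * s], doubled by
    [prim_bound]. *)
Lemma boundary_int_local x0 x1 y0 y1 x y (D : C) (e : R) : 0 <= e ->
  a < x0 -> x0 <= x -> x <= x1 -> x1 < b ->
  c < y0 -> y0 <= y -> y <= y1 -> y1 < d ->
  (forall x' y', x0 <= x' <= x1 -> y0 <= y' <= y1 ->
    cmod (H (mkC x' y') - H (mkC x y) - D * (mkC x' y' - mkC x y))
      <= e * cmod (mkC x' y' - mkC x y)) ->
  cmod (boundary_int x0 x1 y0 y1) <= 4 * e * ((x1 - x0) + (y1 - y0)) ^+ 2.
Proof.
move=> e0 ax0 x0x xx1 x1b cy0 y0y yy1 y1d HD.
set s := (x1 - x0) + (y1 - y0).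
have HD' x' y' : x0 <= x' <= x1 -> y0 <= y' <= y1 ->
    cmod (H (mkC x' y') - H (mkC x y) - D * (mkC x' y' - mkC x y)) <= e * s.
  move=> hx hy; apply: le_trans (HD _ _ hx hy) _; apply: ler_wpM2l => //.
  apply: le_trans (cmod_le _) _; rewrite !(reCD, imCD, reCN, imCN) !reC_mk !imC_mk.
  by rewrite /s; apply: lerD; rewrite ler_norml; lra.
set G := H (mkC x y) - D * mkC x y.
have hh y' : y0 <= y' <= y1 -> cmod (X y' x1 - X y' x0 -
    ((G + D * (ii * cR y')) * cR (x1 - x0) + D * cR ((x1 ^+ 2 - x0 ^+ 2) / 2)))
    <= 2 * (e * s) * (x1 - x0).
  move=> hy; apply: (@prim_bound a b) => //; try lra.
    by move=> x' hx'; apply: horizontal_rcont => //; lra.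
  move=> x' hx'; apply: le_trans (HD' x' y' hx' hy); rewrite le_eqVlt; apply/orP; left; apply/eqP.
  by congr cmod; rewrite /G (mkCE x' y') -/ii; ring.
have hv x' : x0 <= x' <= x1 -> cmod (Y x' y1 - Y x' y0 -
    ((G + D * cR x') * cR (y1 - y0) + (D * ii) * cR ((y1 ^+ 2 - y0 ^+ 2) / 2)))
    <= 2 * (e * s) * (y1 - y0).
  move=> hx; apply: (@prim_bound c d) => //; try lra.
    by move=> y' hy'; apply: vertical_rcont => //; lra.
  move=> y' hy'; apply: le_trans (HD' x' y' hx hy'); rewrite le_eqVlt; apply/orP; left; apply/eqP.
  by congr cmod; rewrite /G (mkCE x' y') -/ii; ring.
have x01 := le_trans x0x xx1; have y01 := le_trans y0y yy1.
have hy0 : y0 <= y0 <= y1 by rewrite lexx.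
have hy1 : y0 <= y1 <= y1 by rewrite lexx andbT.
have hx0 : x0 <= x0 <= x1 by rewrite lexx.
have hx1 : x0 <= x1 <= x1 by rewrite lexx andbT.
move: (hv x1 hx1) (hv x0 hx0) (hh y1 hy1) (hh y0 hy0) => {hh hv HD HD'}.
set E1 := (Y x1 y1 - _ - _); set E2 := (Y x0 y1 - _ - _).
set E3 := (X y1 x1 - _ - _); set E4 := (X y0 x1 - _ - _).
move=> q1 q2 q3 q4.
(* The affine contributions of the four sides cancel identically, without even using
   [ii ^+ 2 = -1]. *)
have -> : boundary_int x0 x1 y0 y1 = E4 + ii * E1 + (- E3 + - (ii * E2)).
  by rewrite /boundary_int /E1 /E2 /E3 /E4 !cRD !cRN; ring.
apply: le_trans (cmodD _ _) _.
have t1 := cmodD E4 (ii * E1); have t2 := cmodD (- E3) (- (ii * E2)).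
rewrite !cmodN !cmodM cmod_ii !mul1r in t1 t2.
have -> : 4 * e * s ^+ 2 = 2 * (2 * (e * s) * (x1 - x0) + 2 * (e * s) * (y1 - y0)).
  by rewrite /s; ring.
lra.
Qed.

End Rectangle.
End Goursat.

Arguments boundary_int {R} H a c x0 x1 y0 y1 : simpl never.
Arguments prim {R} a u x : simpl never.

(** * Goursat's theorem by repeated quartering *)

Section GoursatTheorem.
Variable R : realType.
Local Notation C := (Cplx R).

Lemma boundary_int_split (H : C -> C) (a c x0 x1 x2 y0 y1 y2 : R) :
  boundary_int H a c x0 x2 y0 y2 =
  (boundary_int H a c x0 x1 y0 y1 + boundary_int H a c x1 x2 y0 y1) +
  (boundary_int H a c x0 x1 y1 y2 + boundary_int H a c x1 x2 y1 y2).
Proof.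
rewrite /boundary_int.
move: (prim a _) (prim a _) (prim a _) (prim c _) (prim c _) (prim c _) => X0 X2 X1 Y2 Y0 Y1.
ring.
Qed.

Lemma cmodD4_le (z1 z2 z3 z4 : C) (M : R) :
  cmod z1 <= M -> cmod z2 <= M -> cmod z3 <= M -> cmod z4 <= M ->
  cmod ((z1 + z2) + (z3 + z4)) <= 4 * M.
Proof.
move=> h1 h2 h3 h4; apply: le_trans (cmodD _ _) _.
have t1 := cmodD z1 z2; have t2 := cmodD z3 z4; lra.
Qed.

(** If the integral were nonzero, one quarter at each stage would keep an integral large relative to
    the square of its size; this contradicts derivability at the common point of the nested
    rectangles. *)
Lemma goursat (H : C -> C) (a b c d x0 x1 y0 y1 : R) :
  (forall x y, a <= x <= b -> c <= y <= d -> derivable H (mkC x y) 1) ->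
  a < x0 -> x0 <= x1 -> x1 < b -> c < y0 -> y0 <= y1 -> y1 < d ->
  boundary_int H a c x0 x1 y0 y1 = 0.
Proof.
move=> dH ax0 x01 x1b cy0 y01 y1d.
apply/eqP; apply: contraT; rewrite -cmod_gt0 => B0.
set B := boundary_int H a c in B0.
pose w := x1 - x0; pose h := y1 - y0.
have w0 : 0 <= w by rewrite subr_ge0.
have h0 : 0 <= h by rewrite subr_ge0.
pose q n : R := 2^-1 ^+ n.
have q0 n : 0 < q n by rewrite exprn_gt0 // invr_gt0.
have qS n : q n = q n.+1 + q n.+1 by rewrite /q exprS; lra.
(* Chosen so that the whole rectangle is bad; the [+ 1] keeps the denominator positive when the
   rectangle degenerates to a point. *)
pose eta := cmod (B x0 x1 y0 y1) / (2 * ((w + h) ^+ 2 + 1)).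
have s0 : 0 < 2 * ((w + h) ^+ 2 + 1) by have := sqr_ge0 (w + h); lra.
have eta0 : 0 < eta by rewrite divr_gt0.
(* The threshold is quadratic in the size, so four good quarters would add up to a good
   rectangle. *)
pose bad n (p : R * R) :=
  [/\ x0 <= p.1, p.1 + w * q n <= x1, y0 <= p.2, p.2 + h * q n <= y1 &
  eta * ((w + h) * q n) ^+ 2 < cmod (B p.1 (p.1 + w * q n) p.2 (p.2 + h * q n))].
have bad0 : bad 0%N (x0, y0).
  rewrite /bad /= /q expr0 !mulr1 /w /h; split; try lra.
  rewrite [x0 + _]addrC subrK [y0 + _]addrC subrK -/w -/h.
  rewrite /eta mulrAC ltr_pdivrMr // ltr_pM2l //.
  by have := sqr_ge0 (w + h); lra.
have badS n p : bad n p -> exists p', [/\ bad n.+1 p',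
    p.1 <= p'.1, p'.1 + w * q n.+1 <= p.1 + w * q n,
    p.2 <= p'.2 & p'.2 + h * q n.+1 <= p.2 + h * q n].
  case: p => x y [/= xx0 xx1 yy0 yy1 hbad].
  set u := w * q n.+1; set v := h * q n.+1.
  have u0 : 0 <= u by rewrite mulr_ge0 // ltW.
  have v0 : 0 <= v by rewrite mulr_ge0 // ltW.
  have uE : w * q n = u + u by rewrite qS mulrDr.
  have vE : h * q n = v + v by rewrite qS mulrDr.
  rewrite uE in xx1; rewrite vE in yy1; rewrite mulrDl uE vE in hbad; rewrite uE vE.
  apply: contrapT => no.
  have good x' y' : (x' = x \/ x' = x + u) -> (y' = y \/ y' = y + v) ->
      cmod (B x' (x' + u) y' (y' + v)) <= eta * (u + v) ^+ 2.
    move=> hx hy; rewrite leNgt; apply/negP => hb; apply: no.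
    have {hx} [kx1 kx2] : x <= x' /\ x' + u <= x + (u + u).
      by case: hx => ->; rewrite addrA lerDl lexx ?lerDl ?lerD2l.
    have {hy} [ky1 ky2] : y <= y' /\ y' + v <= y + (v + v).
      by case: hy => ->; rewrite addrA lerDl lexx ?lerDl ?lerD2l.
    exists (x', y'); rewrite /bad /= -/u -/v mulrDl -/u -/v.
    split=> //; split=> //; first exact: le_trans xx0 kx1.
    - exact: le_trans kx2 xx1.
    - exact: le_trans yy0 ky1.
    - exact: le_trans ky2 yy1.
  move: hbad; rewrite ltNge => /negP; apply.
  rewrite !addrA /B (boundary_int_split _ _ _ _ (x + u) _ _ (y + v)) -/B.
  have -> : eta * (u + u + v + v) ^+ 2 = 4 * (eta * (u + v) ^+ 2) by ring.
  by apply: cmodD4_le; apply: good; tauto.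
have [|step Hstep] := @choice _ _ (fun (np : nat * (R * R)) p' => bad np.1 np.2 ->
    [/\ bad np.1.+1 p', np.2.1 <= p'.1,
      p'.1 + w * q np.1.+1 <= np.2.1 + w * q np.1,
      np.2.2 <= p'.2 & p'.2 + h * q np.1.+1 <= np.2.2 + h * q np.1]).
  move=> [n p] /=; have [/badS [p' hp']|nb] := pselect (bad n p); first by exists p'.
  by exists p.
pose fix P n : R * R := if n is m.+1 then step (m, P m) else (x0, y0).
have badP n : bad n (P n).
  by elim: n => [|n IH] //=; have [] := Hstep (n, P n) IH.
have [xs hxs] : exists t, forall n, (P n).1 <= t <= (P n).1 + w * q n.
  apply: nested_intervals => n; first by rewrite mulr_ge0 // ltW.
    by have [] := Hstep (n, P n) (badP n).
  by have [] := Hstep (n, P n) (badP n).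
have [ys hys] : exists t, forall n, (P n).2 <= t <= (P n).2 + h * q n.
  apply: nested_intervals => n; first by rewrite mulr_ge0 // ltW.
    by have [] := Hstep (n, P n) (badP n).
  by have [] := Hstep (n, P n) (badP n).
have [hx0 hy0] := (hxs 0%N, hys 0%N); rewrite /= /q expr0 !mulr1 in hx0 hy0.
have /derivableCP [D HD] : derivable H (mkC xs ys) 1.
  by apply: dH; rewrite /w /h in hx0 hy0; lra.
(* With this accuracy the local estimate gives [4 * (eta / 8) = eta / 2] times the squared size,
   below the badness threshold. *)
have e8 : 0 < eta / 8 by rewrite divr_gt0.
have [r r0 Hr] := HD _ e8.
have wh0 : 0 < w + h + 1 by lra.
have [n hn] : exists n, q n < r / (w + h + 1).
  by apply: expr_small; [lra|rewrite divr_gt0].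
rewrite ltr_pdivlMr // in hn.
have [bx0 bx1 by0 by1] := badP n; rewrite ltNge => /negP nb; exfalso; apply: nb.
have [/andP[lx ux] /andP[ly uy]] := (hxs n, hys n).
have wq : 0 <= w * q n by rewrite mulr_ge0 // ltW.
have hq : 0 <= h * q n by rewrite mulr_ge0 // ltW.
have BL := @boundary_int_local R H a b c d dH (P n).1 ((P n).1 + w * q n)
  (P n).2 ((P n).2 + h * q n) xs ys D (eta / 8) (ltW e8).
have hn' : w * q n + h * q n < r by have := q0 n; nra.
have -> : (w + h) * q n = w * q n + h * q n by ring.
clear q0 qS hn dH Hstep badP badS bad0 hxs hys HD hx0 hy0 B0 s0 bad.
rewrite -/B in BL; clearbody B eta.
move: (P n).1 (P n).2 BL bx0 bx1 by0 by1 lx ux ly uy => px py BL.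
clear P step; clearbody w h; move: (w * q n) (h * q n) wq hq hn' BL => {q wh0 w0 h0 w h} u v.
move=> u0 v0 uv BL bx0 bx1 by0 by1 lx ux ly uy.
have -> : eta * (u + v) ^+ 2 = 4 * (eta / 4) * (px + u - px + (py + v - py)) ^+ 2 by field.
have h1 : cmod (B px (px + u) py (py + v)) <= 4 * (eta / 8) * (px + u - px + (py + v - py)) ^+ 2.
  apply: BL; [exact: lt_le_trans bx0|exact: lx|exact: ux|exact: le_lt_trans x1b|
    exact: lt_le_trans by0|exact: ly|exact: uy|exact: le_lt_trans y1d|].
  move=> x' y' hx' hy'.
  have hr : cmod (mkC x' y' - mkC xs ys) < r.
    apply: le_lt_trans (cmod_le _) (le_lt_trans _ uv).
    rewrite !(reCD, imCD, reCN, imCN) !reC_mk !imC_mk.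
    by apply: lerD; rewrite ler_norml; clear - hx' hy' lx ux ly uy; lra.
  by have := Hr _ hr; rewrite [mkC xs ys + _]addrC subrK.
apply: le_trans h1 _; apply: ler_wpM2r; first exact: sqr_ge0.
by clear - eta0; lra.
Qed.

End GoursatTheorem.

(** * The complex exponential *)

Section ComplexExponential.
Variable R : realType.
Local Notation C := (Cplx R).

Lemma is_derive_eps (f : R -> R) (x d : R) : is_derive x 1 f d ->
  forall e : R, 0 < e -> exists2 r : R, 0 < r &
    forall t, `|t| < r -> `|f (x + t) - f x - d * t| <= e * `|t|.
Proof.
move=> [df dE] e e0.
have /cvgrPdist_lt /(_ e e0) : h^-1 *: ((f \o shift x) (h *: 1) - f x) @[h --> 0^'] --> d.
  by rewrite -dE.
rewrite near_withinE => -[r /= r0 Hr]; exists r => // t tr.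
have [->|t0] := eqVneq t 0; first by rewrite addr0 subrr mulr0 subr0 normr0 mulr0.
have := Hr t; rewrite /ball /= sub0r normrN => /(_ tr t0).
rewrite -[t *: 1]/(t * 1) mulr1 -[t^-1 *: _]/(t^-1 * _) => H.
have -> : f (x + t) - f x - d * t = - (d - t^-1 * (f (t + x) - f x)) * t.
  by rewrite [t + x]addrC; field.
by rewrite normrM normrN ler_wpM2r // ltW.
Qed.

Definition cexp (z : C) : C :=
  mkC (expR (reC z) * cos (imC z)) (expR (reC z) * sin (imC z)).

Lemma cexpD z w : cexp (z + w) = cexp z * cexp w.
Proof.
by rewrite /cexp mkCM reCD imCD expRD cosD sinD; congr mkC; ring.
Qed.

Lemma cmod_cexp z : cmod (cexp z) = expR (reC z).
Proof.
apply/eqP; rewrite -(@eqrXn2 _ 2) ?cmod_ge0 ?expR_ge0 //.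
rewrite cmod_sqr /cexp reC_mk imC_mk !exprMn -mulrDr cos2Dsin2 mulr1 //.
Qed.

Lemma cexp_2pi x y : cexp (mkC x (y + pi *+ 2)) = cexp (mkC x y).
Proof. by rewrite /cexp !imC_mk cosD2pi sinD2pi. Qed.

Lemma cexp_near0 (e : R) : 0 < e -> exists2 r : R, 0 < r &
  forall h : C, cmod h < r -> cmod (cexp h - 1 - h) <= e * cmod h.
Proof.
(* The errors below add up to at most six times [k * cmod h], which [e / 7] covers. *)
move=> e0; pose k := Num.min (e / 7) 1.
have k0 : 0 < k by rewrite lt_min ltr01 andbT divr_gt0.
have k1 : k <= 1 by rewrite ge_min lexx orbT.
have k2 : k <= e / 7 by rewrite ge_min lexx.
have [r1 r10 H1] := is_derive_eps (is_derive_expR 0) k0.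
have [r2 r20 H2] := is_derive_eps (is_derive_cos 0) k0.
have [r3 r30 H3] := is_derive_eps (is_derive_sin 0) k0.
exists (Num.min (Num.min r1 (Num.min r2 r3)) (Num.min (k / 2) (1/2))).
  by rewrite !lt_min r10 r20 r30 /=; lra.
move=> h; rewrite !lt_min => /andP[/andP[hr1 /andP[hr2 hr3]] /andP[hk h2]].
have := re_le h; have := im_le h; set a := reC h; set b := imC h => hb ha.
have := H1 a (le_lt_trans ha hr1); rewrite add0r expR0 mul1r => {H1} H1.
have := H2 b (le_lt_trans hb hr2); rewrite add0r cos0 sin0 oppr0 mul0r subr0 => {H2} H2.
have := H3 b (le_lt_trans hb hr3); rewrite add0r cos0 sin0 mul1r subr0 => {H3} H3.
apply: le_trans (cmod_le _) _.
rewrite !(reCD, imCD, reCN, imCN) -/a -/b /cexp reC_mk imC_mk -/a -/b.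
rewrite [reC 1]/= [imC 1]/= subr0.
clear hr1 hr2 hr3 r10 r20 r30 r1 r2 r3.
have -> : expR a * cos b - 1 - a = (expR a - 1 - a) + expR a * (cos b - 1) by ring.
have -> : expR a * sin b - b = expR a * (sin b - b) + (expR a - 1) * b by ring.
have ea : `|expR a - 1| <= 2 * `|a|.
  have -> : expR a - 1 = (expR a - 1 - a) + a by ring.
  by apply: le_trans (ler_normD _ _) _; have := normr_ge0 a; nra.
have ea2 : expR a <= 2.
  by have := ler_norm (expR a - 1); lra.
have ep := expR_ge0 a.
have t1 := ler_normD (expR a - 1 - a) (expR a * (cos b - 1)).
have t2 := ler_normD (expR a * (sin b - b)) ((expR a - 1) * b).
rewrite !normrM (ger0_norm ep) in t1 t2.
have q1 : expR a * `|cos b - 1| <= 2 * (k * `|b|) by apply: ler_pM.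
have q2 : expR a * `|sin b - b| <= 2 * (k * `|b|) by apply: ler_pM.
have q3 : `|expR a - 1| * `|b| <= k * `|b| by apply: ler_wpM2r => //; lra.
have q4 : k * `|a| <= k * cmod h by rewrite ler_wpM2l // ltW.
have q5 : k * `|b| <= k * cmod h by rewrite ler_wpM2l // ltW.
have q6 : k * cmod h <= e / 7 * cmod h by rewrite ler_wpM2r // cmod_ge0.
have q7 : 0 <= e * cmod h by rewrite mulr_ge0 ?cmod_ge0 // ltW.
lra.
Qed.

Lemma derivable_cexp z : derivable cexp z 1.
Proof.
apply/derivableCP; exists (cexp z) => e e0.
have p : 0 < expR (reC z) := expR_gt0 _.
have [|r r0 Hr] := @cexp_near0 (e / expR (reC z)); first by rewrite divr_gt0.
exists r => // h /Hr H.
have -> : cexp (z + h) - cexp z - cexp z * h = cexp z * (cexp h - 1 - h).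
  by rewrite cexpD; ring.
by rewrite cmodM cmod_cexp mulrC -ler_pdivlMr // mulrAC.
Qed.

Lemma cexp_surj z : z != 0 -> exists y, z = cexp (mkC (ln (cmod z)) y).
Proof.
move=> z0; have m0 : 0 < cmod z by rewrite cmod_gt0.
have mE : expR (ln (cmod z)) = cmod z by rewrite lnK.
have := cmod_sqr z; set a := reC z; set b := imC z => sq.
pose c := a / cmod z; pose s := b / cmod z.
have cs : c ^+ 2 + s ^+ 2 = 1.
  by rewrite /c /s !expr_div_n -mulrDl -sq divff // expf_neq0 // gt_eqF.
have c1 : -1 <= c <= 1.
  rewrite -ler_norml -(@ler_pXn2r _ 2) ?nnegrE // expr1n real_normK ?num_real //.
  by have := sqr_ge0 s; lra.
have ck : cos (acos c) = c by apply: acosK; rewrite in_itv.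
have sk : sin (acos c) = `|s|.
  by rewrite sin_acos // -cs [X in Num.sqrt X](_ : _ = s ^+ 2) ?sqrtr_sqr //; ring.
have ac : a = cmod z * c by rewrite /c mulrC divfK // gt_eqF.
have bs : b = cmod z * s by rewrite /s mulrC divfK // gt_eqF.
(* [acos] always gives a nonnegative sine, so the sign of the imaginary part decides between
   [acos c] and its opposite. *)
have [s0|s0] := leP 0 s.
  exists (acos c); rewrite /cexp reC_mk imC_mk mE ck sk ger0_norm //.
  by rewrite [LHS]mkC_eta -/a -/b -ac -bs.
exists (- acos c); rewrite /cexp reC_mk imC_mk mE cosN sinN ck sk ltr0_norm // opprK.
by rewrite [LHS]mkC_eta -/a -/b -ac -bs.
Qed.

End ComplexExponential.

(** * Mean value property and the local strong maximum principle *)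

Section StrongMaximum.
Variable R : realType.
Local Notation C := (Cplx R).

Lemma derivable_compC (f g : C -> C) z :
  derivable f z 1 -> derivable g (f z) 1 -> derivable (g \o f) z 1.
Proof.
move=> /derivableCP[d Hd] /derivableCP[d' Hd']; apply/derivableCP; exists (d' * d) => e e0.
have p0 : 0 < 2 * (cmod d + 1) by have := cmod_ge0 d; lra.
have p0' : 0 < 2 * (cmod d' + 1) by have := cmod_ge0 d'; lra.
pose e1 := Num.min 1 (e / (2 * (cmod d' + 1))).
have e10 : 0 < e1 by rewrite lt_min ltr01 divr_gt0.
have [r1 r10 H1] := Hd _ e10.
have [|r2 r20 H2] := Hd' (e / (2 * (cmod d + 1))); first by rewrite divr_gt0.
have p1 : 0 < cmod d + 1 by have := cmod_ge0 d; lra.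
exists (Num.min r1 (r2 / (cmod d + 1))); first by rewrite lt_min r10 divr_gt0.
move=> h; rewrite lt_min ltr_pdivlMr // => /andP[/H1 hr1 hr2] {H1}.
set k := f (z + h) - f z in hr1 *.
have kE : f (z + h) = f z + k by rewrite /k [RHS]addrC subrK.
have kd : cmod k <= (cmod d + 1) * cmod h.
  apply: le_trans (cmod_rtri k (d * h)) _; rewrite cmodM mulrDl mul1r addrC lerD2l.
  apply: le_trans hr1 _; rewrite ler_piMl ?cmod_ge0 // ge_min lexx //.
have /H2 : cmod k < r2 by apply: le_lt_trans kd _; rewrite mulrC.
rewrite /= kE => hk.
have -> : g (f z + k) - g (f z) - d' * d * h = (g (f z + k) - g (f z) - d' * k) + d' * (k - d * h).
  by ring.
apply: le_trans (cmodD _ _) _; rewrite cmodM.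
have -> : e * cmod h = e / 2 * cmod h + e / 2 * cmod h by field.
apply: lerD.
  apply: le_trans hk _.
  have -> : e / 2 * cmod h = e / (2 * (cmod d + 1)) * ((cmod d + 1) * cmod h) by field; lra.
  by rewrite ler_pM2l ?divr_gt0.
have -> : e / 2 * cmod h = (cmod d' + 1) * (e / (2 * (cmod d' + 1)) * cmod h) by field; lra.
apply: ler_pM; rewrite ?cmod_ge0 //; first lra.
by apply: le_trans hr1 _; rewrite ler_wpM2r ?cmod_ge0 // ge_min lexx orbT.
Qed.

(** Equalities between limits are obtained throughout by applying this to the modulus of a
    difference. *)
Lemma le0_eps (x K : R) : (forall e : R, 0 < e -> x <= e * K) -> x <= 0.
Proof.
move=> H; rewrite leNgt; apply/negP => x0.
have [K0|K0] := leP K 0; first by have := H 1 ltr01; lra.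
have := H (x / (2 * K)); rewrite divr_gt0 //; last by lra.
move=> /(_ isT).
have -> : x / (2 * K) * K = x / 2 by field; lra.
lra.
Qed.

(** Goursat on a rectangle one period high: the horizontal sides cancel by periodicity. For
    [H w = G (c + cexp w)] the vertical integrals are those of [G] over circles around [c], which
    thus do not depend on the radius. *)
Lemma periodic_mean (H : C -> C) (L s0 s1 t : R) :
  (forall x y, x < L -> derivable H (mkC x y) 1) ->
  (forall x y, H (mkC x (y + pi *+ 2)) = H (mkC x y)) ->
  s0 <= s1 -> s1 < L ->
  let Y s := prim (t - pi - 1) (fun y => H (mkC s y)) in
  Y s1 (t + pi) - Y s1 (t - pi) = Y s0 (t + pi) - Y s0 (t - pi).
Proof.
move=> dH pH s01 s1L Y; have p0 := pi_gt0 R.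
have := @goursat R H (s0 - 1) ((s1 + L) / 2) (t - pi - 1) (t + pi + 1) s0 s1 (t - pi) (t + pi).
have -> : boundary_int H (s0 - 1) (t - pi - 1) s0 s1 (t - pi) (t + pi) =
    mkC 0 1 * ((Y s1 (t + pi) - Y s1 (t - pi)) - (Y s0 (t + pi) - Y s0 (t - pi))).
  rewrite /boundary_int.
  have -> : (fun x => H (mkC x (t + pi))) = (fun x => H (mkC x (t - pi))).
    apply/funext => x; rewrite -[RHS]pH; congr (H (mkC x _)); ring.
  by rewrite /Y; ring.
move=> h; have {h} :
    mkC 0 1 * ((Y s1 (t + pi) - Y s1 (t - pi)) - (Y s0 (t + pi) - Y s0 (t - pi))) = 0.
  by apply: h => [x y /andP[_ hx] _||||||]; [apply: dH; lra|lra..].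
move/eqP; rewrite mulf_eq0 => /orP[/eqP[/eqP]|]; first by rewrite oner_eq0.
by rewrite subr_eq0 => /eqP.
Qed.

(** On the circle through [z] the mean of [G] is 1 while its real part is at most 1; hence the real
    part equals 1 at [z], and the bound on the modulus kills the imaginary part. *)
Lemma strong_max_normalized (G : C -> C) (c : C) (r : R) :
  (forall z, cmod (z - c) < r -> derivable G z 1) -> G c = 1 ->
  (forall z, cmod (z - c) < r -> cmod (G z) <= 1) ->
  forall z, cmod (z - c) < r -> G z = 1.
Proof.
move=> dG Gc Gle z zr; have p0 := pi_gt0 R.
have [->//|zc] := eqVneq z c.
have zc0 : z - c != 0 by rewrite subr_eq0.
have [t zt] := cexp_surj zc0; set s1 := ln _ in zt.
have m0 : 0 < cmod (z - c) by rewrite cmod_gt0.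
have r0 : 0 < r := lt_trans m0 zr.
pose L := ln r.
have s1L : s1 < L by rewrite /s1 /L ltr_ln ?posrE.
pose H w := G (c + cexp w).
have inball x y : x < L -> cmod (c + cexp (mkC x y) - c) < r.
  by move=> xL; rewrite addrC addKr cmod_cexp reC_mk -(lnK (x := r)) ?posrE // ltr_expR.
have dH x y : x < L -> derivable H (mkC x y) 1.
  move=> xL; apply: (@derivable_compC (fun w => c + cexp w) G).
    by apply: derivableD; [exact: derivable_cst|exact: derivable_cexp].
  exact/dG/inball.
have pH x y : H (mkC x (y + pi *+ 2)) = H (mkC x y) by rewrite /H cexp_2pi.
have H1 x y : x < L -> cmod (H (mkC x y)) <= 1 by move=> xL; apply/Gle/inball.
have Hcont s y : s < L -> rcont (fun y => H (mkC s y)) y.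
  move=> sL; apply: (@vertical_rcont R H s s y y) => [x y'||]; last 2 first.
  - by rewrite lexx.
  - by rewrite lexx.
  by move=> /le_anti <- _; apply: dH.
pose Y s := prim (t - pi - 1) (fun y => H (mkC s y)).
(* Moving [s0] far to the left shrinks the circle to [c], where the integrand is within [e] of
   [G c = 1]. *)
have J1 : Y s1 (t + pi) - Y s1 (t - pi) = cR (pi *+ 2).
  apply/eqP; rewrite -subr_eq0 -cmod_eq0 eq_le cmod_ge0 andbT.
  apply: (@le0_eps _ (2 * (pi *+ 2))) => e e0.
  have [|d d0 Hd] := derivable_ccont setT (dG c _) e0; first by rewrite subrr cmod0.
  pose s0 := Num.min s1 (ln d - 1).
  have s0s1 : s0 <= s1 by rewrite ge_min lexx.
  have s0d : s0 < ln d by rewrite gt_min; apply/orP; right; lra.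
  have -> := periodic_mean t dH pH s0s1 s1L.
  have := @prim_bound R (t - pi - 1) (t + pi + 1) (fun y => H (mkC s0 y)) (t - pi) (t + pi) 1 0 e.
  rewrite mul1r mul0r addr0.
  have -> : t + pi - (t - pi) = pi *+ 2 by ring.
  rewrite mulrA [e * 2]mulrC; apply; [|lra|lra|lra|].
    by move=> y _; apply: Hcont; exact: le_lt_trans s1L.
  move=> y _; rewrite mul0r addr0 -Gc ltW //; apply: Hd => //.
  by rewrite addrC addKr cmod_cexp reC_mk -(lnK (x := d)) ?posrE // ltr_expR.
(* The derivative of [g] is [1 - reC H], so [g] is nondecreasing; with equal end values it is
   constant, and its derivative vanishes at the midpoint [t]. *)
pose g y := y - reC (Y s1 y).
have dg y : t - pi - 1 < y < t + pi + 1 -> is_derive y 1 g (1 - reC (H (mkC s1 y))).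
  move=> hy; apply: is_deriveB.
  apply: (@prim_re R _ (t + pi + 1) (fun y => H (mkC s1 y))) => //.
  by move=> x _; exact: Hcont.
have g_mono y1 y2 : t - pi <= y1 -> y1 <= y2 -> y2 <= t + pi -> g y1 <= g y2.
  move=> h1 h12 h2.
  have [||x _ xE] := @MVT_segment R g (fun y => 1 - reC (H (mkC s1 y))) y1 y2 h12.
  - by move=> x /[!in_itv] /= hx; apply: dg; lra.
  - apply: continuous_in_subspaceT => x; rewrite inE /= in_itv /= => hx.
    by apply: is_derive_cont; apply: dg; lra.
  rewrite -subr_ge0 xE mulr_ge0 ?subr_ge0 //.
  apply: le_trans (le_trans (re_le _) (H1 _ x s1L)); exact: ler_norm.
have gE : g (t + pi) = g (t - pi).
  have := congr1 (@reC R) J1; rewrite reCD reCN [reC (cR _)]/= /g; lra.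
have Re1 : reC (H (mkC s1 t)) = 1.
  have h1 : reC (H (mkC s1 t)) <= 1.
    apply: le_trans (le_trans (re_le _) (H1 _ t s1L)); exact: ler_norm.
  apply/eqP; rewrite eq_le h1 /= -subr_le0.
  apply: (@le0_eps _ 1) => e e0; rewrite mulr1.
  have [|q q0 Hq] := is_derive_eps (dg t _) e0; first lra.
  pose u := Num.min (q / 2) pi.
  have u0 : 0 < u by rewrite lt_min p0 andbT divr_gt0.
  have up : u <= pi by rewrite ge_min lexx orbT.
  have uq : u < q by rewrite gt_min; apply/orP; left; lra.
  have := Hq u; rewrite gtr0_norm // => /(_ uq).
  have -> : g (t + u) = g t.
    apply/eqP; rewrite eq_le; apply/andP; split.
      apply: le_trans (@g_mono (t + u) (t + pi) _ _ _) _; [lra..|].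
      by rewrite gE; apply: g_mono; lra.
    by apply: g_mono; lra.
  rewrite subrr sub0r normrN normrM (gtr0_norm u0) ler_pM2r //.
  exact: le_trans (ler_norm _).
have zE : z = c + cexp (mkC s1 t) by rewrite -zt addrC subrK.
have Gz : G z = H (mkC s1 t) by rewrite zE.
have := H1 s1 t s1L; rewrite Gz.
set w := H _ in Re1 *; move=> w1.
have := cmod_sqr w; rewrite Re1 => sq.
have : imC w ^+ 2 <= 0 by have := cmod_ge0 w; nra.
move=> hh; have /eqP : imC w ^+ 2 == 0 by rewrite eq_le hh sqr_ge0.
move=> /eqP; rewrite sqrf_eq0 => /eqP i0.
by rewrite [w]mkC_eta Re1 i0.
Qed.

Lemma strong_max (F : C -> C) (c : C) (r : R) :
  (forall z, cmod (z - c) < r -> derivable F z 1) ->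
  (forall z, cmod (z - c) < r -> cmod (F z) <= cmod (F c)) ->
  forall z, cmod (z - c) < r -> F z = F c.
Proof.
move=> dF Fle z zr.
have [F0|F0] := eqVneq (F c) 0.
  by apply/eqP; rewrite F0 -cmod_eq0 eq_le cmod_ge0 -cmod0 -{1}F0 Fle.
pose G w := F w * (F c)^-1.
have dG w : cmod (w - c) < r -> derivable G w 1.
  move=> wr; exact: (@derivableM _ _ F (cst (F c)^-1) w 1 (dF w wr) (derivable_cst _ _ _)).
have Gc : G c = 1 by rewrite /G divff.
have Gle w : cmod (w - c) < r -> cmod (G w) <= 1.
  by move=> wr; rewrite cmodM cmodV ler_pdivrMr ?cmod_gt0 // mul1r Fle.
have h := strong_max_normalized dG Gc Gle zr.
by rewrite -[F z](mulfVK F0) -/(G z) h mul1r.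
Qed.

End StrongMaximum.

(** * Rules for derivability and for continuity relative to a set *)

Section DerivableRules.
Variable R : realType.
Local Notation C := (Cplx R).
Implicit Types (f g : C -> C) (K V : set C) (z : C).

Lemma derC_near f g z (r : R) : 0 < r -> (forall w, cmod (w - z) < r -> f w = g w) ->
  derivable f z 1 -> derivable g z 1.
Proof.
move=> r0 fg /derivableCP[d H]; apply/derivableCP; exists d => e e0.
have [s s0 Hs] := H e e0; exists (Num.min r s); first by rewrite lt_min r0.
move=> h; rewrite lt_min => /andP[hr /Hs].
rewrite -!fg //; last by rewrite addrC addKr.
by rewrite subrr cmod0.
Qed.

Lemma derC_cst (k : C) z : derivable (fun _ : C => k) z 1.
Proof. exact: derivable_cst. Qed.

Lemma derC_id z : derivable (fun w : C => w) z 1.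
Proof. exact: derivable_id. Qed.

Lemma derC_add f g z : derivable f z 1 -> derivable g z 1 -> derivable (fun w => f w + g w) z 1.
Proof. by move=> hf hg; exact: (@derivableD _ _ _ f g z 1 hf hg). Qed.

Lemma derC_sub f g z : derivable f z 1 -> derivable g z 1 -> derivable (fun w => f w - g w) z 1.
Proof. by move=> hf hg; exact: (@derivableB _ _ _ f g z 1 hf hg). Qed.

Lemma derC_mul f g z : derivable f z 1 -> derivable g z 1 -> derivable (fun w => f w * g w) z 1.
Proof. by move=> hf hg; exact: (@derivableM _ _ f g z 1 hf hg). Qed.

Lemma derC_inv f z : f z != 0 -> derivable f z 1 -> derivable (fun w => (f w)^-1) z 1.
Proof. by move=> f0 hf; exact: (@derivableV _ _ f z 1 f0 hf). Qed.

Lemma derC_div f g z : g z != 0 -> derivable f z 1 -> derivable g z 1 ->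
  derivable (fun w => f w / g w) z 1.
Proof. by move=> g0 hf hg; exact: (derC_mul hf (derC_inv g0 hg)). Qed.

Lemma derC_exp f n z : derivable f z 1 -> derivable (fun w => f w ^+ n) z 1.
Proof.
move=> hf; elim: n => [|n IH]; first exact: derC_cst.
have -> : (fun w => f w ^+ n.+1) = (fun w => f w * f w ^+ n) by apply/funext => w; rewrite exprS.
exact: (derC_mul hf IH).
Qed.

Lemma derC_horner (p : {poly C}) z : derivable (fun w => p.[w]) z 1.
Proof.
elim/poly_ind: p => [|p k IH].
  have -> : (fun w => (0 : {poly C}).[w]) = (fun _ : C => 0) by apply/funext => w; rewrite horner0.
  exact: derC_cst.
have -> : (fun w => (p * 'X + k%:P).[w]) = (fun w => p.[w] * w + k).
  by apply/funext => w; rewrite hornerMXaddC.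
exact (@derC_add (fun w => p.[w] * w) (fun _ => k) z
  (@derC_mul (fun w => p.[w]) (fun w => w) z IH (@derC_id z)) (@derC_cst k z)).
Qed.

Lemma derC_ratfun (p q : {poly C}) z : q.[z] != 0 -> derivable (ratfun p q) z 1.
Proof.
by move=> q0; exact: (derC_div q0 (@derC_horner p z) (@derC_horner q z)).
Qed.

Lemma ccontS K K' f z : K `<=` K' -> ccont K' f z -> ccont K f z.
Proof.
by move=> KK' H e e0; have [d d0 Hd] := H e e0; exists d => // w /KK'; exact: Hd.
Qed.

Lemma ccont_sub K f g z : ccont K f z -> ccont K g z -> ccont K (fun w => f w - g w) z.
Proof.
move=> Hf Hg e e0; have e2 : 0 < e / 2 by rewrite divr_gt0.
have [d1 d10 H1] := Hf _ e2; have [d2 d20 H2] := Hg _ e2.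
exists (Num.min d1 d2); first by rewrite lt_min d10.
move=> w Kw; rewrite lt_min => /andP[/(H1 _ Kw) h1 /(H2 _ Kw) h2].
have -> : f w - g w - (f z - g z) = (f w - f z) + - (g w - g z) by ring.
by apply: le_lt_trans (cmodD _ _) _; rewrite cmodN; lra.
Qed.

Lemma ccont_mul K f g z : ccont K f z -> ccont K g z -> ccont K (fun w => f w * g w) z.
Proof.
move=> Hf Hg e e0.
pose A := cmod (f z) + 1; pose B := cmod (g z) + 1.
have A0 : 0 < A by rewrite /A; have := cmod_ge0 (f z); lra.
have B0 : 0 < B by rewrite /B; have := cmod_ge0 (g z); lra.
have [|d1 d10 H1] := Hf (e / (2 * B)); first by rewrite divr_gt0 // mulr_gt0.
have [|d2 d20 H2] := Hg (Num.min 1 (e / (2 * A))).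
  by rewrite lt_min ltr01 divr_gt0 // mulr_gt0.
exists (Num.min d1 d2); first by rewrite lt_min d10.
move=> w Kw; rewrite lt_min => /andP[/(H1 _ Kw) h1 /(H2 _ Kw)].
rewrite lt_min => /andP[h2 h3].
have -> : f w * g w - f z * g z = (f w - f z) * g w + f z * (g w - g z) by ring.
apply: le_lt_trans (cmodD _ _) _; rewrite !cmodM.
have gw : cmod (g w) <= B by rewrite /B; have := cmod_rtri (g w) (g z); lra.
have -> : e = e / (2 * B) * B + A * (e / (2 * A)).
  by field; rewrite !gt_eqF.
apply: ltr_leD.
  apply: le_lt_trans (_ : cmod (f w - f z) * B < _); first by rewrite ler_wpM2l ?cmod_ge0.
  by rewrite ltr_pM2r.
apply: ler_pM; rewrite ?cmod_ge0 //; last exact: ltW.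
by rewrite /A; lra.
Qed.

Lemma ccont_comp K K' f g z : ccont K f z -> (forall w, K w -> K' (f w)) ->
  ccont K' g (f z) -> ccont K (fun w => g (f w)) z.
Proof.
move=> Hf KK' Hg e e0; have [d1 d10 H1] := Hg e e0.
have [d2 d20 H2] := Hf _ d10; exists d2 => // w Kw h; apply: H1; first exact: KK'.
exact: H2.
Qed.

End DerivableRules.

(** * Extrema on compact sets, the global maximum principle and the open mapping property *)

Section Compactness.
Variable R : realType.
Local Notation C := (Cplx R).
Implicit Types (f g : C -> C) (K V : set C) (z : C).

Definition eclosed K := forall z, (forall e : R, 0 < e -> exists2 w, K w & cmod (w - z) < e) -> K z.
Definition ebounded K := exists M : R, forall z, K z -> cmod z <= M.
Definition eopen V := forall z, V z -> exists2 e : R, 0 < e & forall w, cmod (w - z) < e -> V w.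

Lemma compact_max K (u : C -> R) (B : R) z0 : K z0 -> eclosed K -> ebounded K ->
  (forall z, K z -> u z <= B) ->
  (forall z, K z -> forall e : R, 0 < e -> exists2 d : R, 0 < d &
     forall w, K w -> cmod (w - z) < d -> `|u w - u z| < e) ->
  exists2 m, K m & forall z, K z -> u z <= u m.
Proof.
move=> Kz0 cK [M KM] uB cu.
have hs : has_sup (u @` K) by split; [exists (u z0); exists z0|exists B => _ [z /uB + <-]].
pose s := sup (u @` K).
have us z : K z -> u z <= s by move=> Kz; apply: ub_le_sup; [case: hs|exists z].
have [v Hv] : {v : nat -> C & forall n, K (v n) /\ s - n.+1%:R^-1 < u (v n)}.
  apply: (@choice _ _ (fun (n : nat) z => K z /\ s - n.+1%:R^-1 < u z)) => n.
  have [|_ [z Kz <-] hz] := @sup_adherent _ (u @` K) n.+1%:R^-1 _ hs; first by rewrite invr_gt0.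
  by exists z.
have [m Hm] := @bolzano_weierstrassC R v M (fun n => KM _ (Hv n).1).
have Km : K m.
  by apply: cK => e e0; have [n _ hn] := Hm e e0 0%N; exists (v n) => //; case: (Hv n).
exists m => // z /us /le_trans; apply; rewrite leNgt; apply/negP => ms.
have e0 : 0 < (s - u m) / 2 by rewrite divr_gt0 // subr_gt0.
have [d d0 Hd] := cu _ Km _ e0.
have [N HN] : exists N : nat, (N.+1%:R : R)^-1 < (s - u m) / 2.
  exists (Num.Def.archi_bound ((s - u m) / 2)^-1).
  rewrite invf_plt ?posrE //; apply: lt_trans (archi_boundP _) _; first by rewrite ltW // invr_gt0.
  by rewrite ltr_nat.
have [n Nn hn] := Hm d d0 N.
have [Kn un] := Hv n.
have := Hd _ Kn hn; rewrite ltr_norml => /andP[_ h].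
have h2 : (n.+1%:R : R)^-1 <= N.+1%:R^-1 by rewrite lef_pV2 ?posrE // ler_nat.
move: un (le_lt_trans h2 HN) h; move: (n.+1%:R^-1) (u (v n)) (u m) => a b c; clear; lra.
Qed.

Lemma cmod_dist (z w : C) : `|cmod z - cmod w| <= cmod (z - w).
Proof.
by rewrite ler_norml; have := cmod_rtri z w; have := cmod_rtri w z; rewrite (cmodB w z); lra.
Qed.

Lemma compact_max_modulus K f z0 : K z0 -> eclosed K -> ebounded K ->
  (forall z, K z -> ccont K f z) -> exists2 m, K m & forall z, K z -> cmod (f z) <= cmod (f m).
Proof.
move=> Kz0 cK bK cf.
(* A bounded increasing function of [cmod (f z)]: boundedness of [f] need not be known. *)
pose u z : R := 1 - (1 + cmod (f z))^-1.
have p1 z : 0 < 1 + cmod (f z) by have := cmod_ge0 (f z); lra.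
have [|z Kz e e0|m Km Hm] := @compact_max K u 1 z0 Kz0 cK bK.
- by move=> z _; rewrite /u gerBl invr_ge0 ltW.
- have [d d0 Hd] := cf z Kz e e0; exists d => // w Kw /(Hd w Kw) h.
  have -> : u w - u z = (cmod (f w) - cmod (f z)) / ((1 + cmod (f w)) * (1 + cmod (f z))).
    by rewrite /u; field; rewrite !gt_eqF.
  have pp : 0 < (1 + cmod (f w)) * (1 + cmod (f z)) by rewrite mulr_gt0.
  rewrite normrM normfV (gtr0_norm pp) ltr_pdivrMr //.
  apply: le_lt_trans (cmod_dist _ _) (lt_le_trans h _).
  rewrite ler_peMr ?(ltW e0) //.
  by have := cmod_ge0 (f w); have := cmod_ge0 (f z); nra.
exists m => // z /Hm; rewrite /u lerD2l lerN2 lef_pV2 ?posrE //; lra.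
Qed.

Lemma max_principle K V f (m : R) : eclosed K -> ebounded K -> V `<=` K -> eopen V ->
  (forall z, K z -> ccont K f z) -> (forall z, V z -> derivable f z 1) ->
  (forall z, K z -> ~ V z -> cmod (f z) <= m) -> forall z, K z -> cmod (f z) <= m.
Proof.
move=> cK bK VK oV cf df fm z0 Kz0.
have [mx Kmx Hmx] := compact_max_modulus Kz0 cK bK cf.
apply: le_trans (Hmx _ Kz0) _; rewrite leNgt; apply/negP => lt.
pose L : set C := [set z | K z /\ cmod (f z) = cmod (f mx)].
have Lmx : L mx by [].
have [M HM] := bK.
have cL : eclosed L.
  move=> z Hz; have Kz : K z by apply: cK => e /Hz[w [Kw _] hw]; exists w.
  split => //; apply/eqP; rewrite -subr_eq0 -normr_eq0 eq_le normr_ge0 andbT.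
  apply: (@le0_eps _ _ 1) => e e0; rewrite mulr1.
  have [d d0 Hd] := cf z Kz e e0; have [w [Kw <-] hw] := Hz d d0.
  by apply: le_trans (cmod_dist _ _) _; rewrite cmodB ltW // Hd.
have [|z [Kz _]|z Lz e e0|p [Kp pE] Hp] := @compact_max L (@reC R) M mx Lmx cL.
- by exists M => z [Kz _]; exact: HM.
- by apply: le_trans (HM z Kz); apply: le_trans (re_le _); exact: ler_norm.
- exists e => // w _ h; apply: le_lt_trans h; rewrite -reCN -reCD; exact: re_le.
have Vp : V p by apply: contrapT => /(fm _ Kp); rewrite pE leNgt lt.
have [r r0 Hr] := oV _ Vp.
have cst w : cmod (w - p) < r -> f w = f p.
  apply: strong_max => z hz; first by apply/df/Hr.
  by rewrite pE; apply/Hmx/VK/Hr.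
have r2 : 0 < r / 2 by rewrite divr_gt0.
have hq : cmod (p + cR (r / 2) - p) < r by rewrite addrC addKr cmod_cR gtr0_norm //; lra.
have : L (p + cR (r / 2)) by split; [apply/VK/Hr|rewrite cst].
move=> /Hp; rewrite reCD [reC (cR _)]/=; lra.
Qed.

(* Applies the maximum principle to [h * e ^+ j] and lets [j] tend to infinity. *)
Lemma vanishing K V (h e : C -> C) (rho : R) : eclosed K -> ebounded K -> V `<=` K -> eopen V ->
  0 <= rho ->
  (forall z, K z -> ccont K h z) -> (forall z, V z -> derivable h z 1) ->
  (forall z, K z -> ccont K e z) -> (forall z, V z -> derivable e z 1) ->
  (forall z, K z -> ~ V z -> h z = 0 \/ cmod (e z) <= rho) ->
  forall z, K z -> rho < cmod (e z) -> h z = 0.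
Proof.
move=> cK bK VK oV rho0 ch dh ce de bd z Kz ez.
have [m Km Hm] := compact_max_modulus Kz cK bK ch.
have e0 : 0 < cmod (e z) := le_lt_trans rho0 ez.
have B j : cmod (h z) * cmod (e z) ^+ j <= cmod (h m) * rho ^+ j.
  rewrite -cmodX -cmodM.
  apply: (@max_principle K V (fun w => h w * e w ^+ j) _ cK bK VK oV _ _ _ z Kz) => w.
  - move=> Kw; apply: ccont_mul; first exact: ch.
    elim: j => [|j IH]; first by move=> ? ?; exists 1 => // ? _ _; rewrite !expr0 subrr cmod0.
    have -> : (fun v => e v ^+ j.+1) = (fun v => e v * e v ^+ j).
      by apply/funext => v; rewrite exprS.
    by apply: ccont_mul => //; exact: ce.
  - by move=> Vw; exact: (@derC_mul _ h (fun v => e v ^+ j) w (dh w Vw)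
      (@derC_exp _ e j w (de w Vw))).
  - move=> Kw nV; case: (bd w Kw nV) => [->|ew].
      by rewrite mul0r cmod0 mulr_ge0 ?cmod_ge0 ?exprn_ge0.
    rewrite cmodM cmodX; apply: ler_pM; rewrite ?cmod_ge0 ?exprn_ge0 ?cmod_ge0 ?Hm //.
    by apply: lerXn2r; rewrite ?nnegrE ?cmod_ge0.
apply/eqP; rewrite -cmod_eq0 eq_le cmod_ge0 andbT.
apply: (@le0_eps _ _ (cmod (h m))) => d d0.
have [|j hj] := @expr_small _ (rho / cmod (e z)) d _ d0.
  by rewrite divr_ge0 ?cmod_ge0 //= ltr_pdivrMr // mul1r.
have := B j; rewrite -ler_pdivlMr ?exprn_gt0 // -mulrA -expr_div_n => /le_trans; apply.
by rewrite mulrC ler_wpM2r ?cmod_ge0 // ltW.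
Qed.

(** If [w] were omitted, the inverse of [f - w] would be holomorphic on the disk and bounded by
    [2 / c] on the circle, yet exceed [2 / c] at the centre. *)
Lemma open_mapping f z0 (d c : R) : 0 < d -> 0 < c ->
  (forall z, cmod (z - z0) <= d -> derivable f z 1) ->
  (forall z, cmod (z - z0) = d -> c <= cmod (f z - f z0)) ->
  forall w, cmod (w - f z0) < c / 2 -> exists2 z, cmod (z - z0) < d & f z = w.
Proof.
move=> d0 c0 df fc w wc; apply: contrapT => no.
have nz z : cmod (z - z0) <= d -> f z - w != 0.
  rewrite le_eqVlt => /orP[/eqP zd|zd]; last first.
    by rewrite subr_eq0; apply/eqP => fw; apply: no; exists z.
  rewrite -cmod_gt0; have := cmod_tri (f z) (f z0) w; have := fc z zd; lra.
pose K : set C := [set z | cmod (z - z0) <= d].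
pose V : set C := [set z | cmod (z - z0) < d].
have dk z : K z -> derivable (fun z => (f z - w)^-1) z 1.
  move=> Kz; exact: (@derC_inv _ (fun z => f z - w) z (nz z Kz)
    (derC_sub (df z Kz) (@derC_cst _ w z))).
have := @max_principle K V (fun z => (f z - w)^-1) (2 / c).
have Kz0 : K z0 by rewrite /K /= subrr cmod0 ltW.
move=> /(_ _ _ _ _ _ _ _ z0 Kz0) mp.
have : cmod (f z0 - w)^-1 <= 2 / c.
  apply: mp.
  - move=> z Hz; rewrite /K /= leNgt; apply/negP => h.
    have [|v Kv hv] := Hz (cmod (z - z0) - d); first by lra.
    by have := cmod_tri z z0 v; rewrite (cmodB z v); rewrite /K /= in Kv; lra.
  - by exists (d + cmod z0) => z Kz; have := cmod_rtri z z0; rewrite /K /= in Kz; lra.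
  - by move=> z; exact: ltW.
  - move=> z Vz; exists (d - cmod (z - z0)); first by rewrite subr_gt0.
    by move=> v hv; rewrite /V /=; have := cmod_tri v z0 z; lra.
  - by move=> z Kz; apply: derivable_ccont; exact: dk.
  - by move=> z /ltW; exact: dk.
  - move=> z Kz nV; have zd : cmod (z - z0) = d.
      by apply/eqP; rewrite eq_le Kz /= leNgt; apply/negP.
    rewrite cmodV -[2 / c]invrK lef_pV2 ?posrE ?cmod_gt0 ?nz ?invf_div ?divr_gt0 //.
    by have := cmod_tri (f z) (f z0) w; have := fc z zd; lra.
rewrite cmodV -[2 / c]invrK lef_pV2 ?posrE ?cmod_gt0 ?nz ?invf_div ?divr_gt0 //.
by rewrite cmodB leNgt wc.
Qed.

End Compactness.

(** * Rational functions are open; connectedness of the unit interval *)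

Section Rational.
Variable R : realType.
Local Notation C := (Cplx R).
Implicit Types (f g : C -> C) (K V : set C) (z w u v : C).

Lemma ccont_horner K (p : {poly C}) z : ccont K (fun w => p.[w]) z.
Proof. by apply: derivable_ccont; exact: derC_horner. Qed.

Lemma ccont_ratfun K (p q : {poly C}) z : q.[z] != 0 -> ccont K (ratfun p q) z.
Proof. by move=> q0; apply: derivable_ccont; exact: derC_ratfun. Qed.

Lemma horner_neq0_near (q : {poly C}) z : q.[z] != 0 ->
  exists2 d : R, 0 < d & forall w, cmod (w - z) < d -> cmod q.[z] / 2 < cmod q.[w].
Proof.
move=> q0; have m0 : 0 < cmod q.[z] / 2 by rewrite divr_gt0 // cmod_gt0.
have [d d0 Hd] := @ccont_horner setT q z _ m0.
exists d => // w /(Hd w I) h; have := cmod_rtri q.[z] q.[w]; rewrite cmodB; lra.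
Qed.

(** Factoring the power of ['X - z0] out of the numerator of [ratfun P Q - ratfun P Q z0] bounds
    this difference from below on a small circle, as [open_mapping] requires. *)
Lemma ratfun_open (P Q : {poly C}) z0 (del : R) : Q.[z0] != 0 ->
  P - (ratfun P Q z0)%:P * Q != 0 -> 0 < del ->
  exists2 eta : R, 0 < eta & forall w, cmod (w - ratfun P Q z0) < eta ->
    exists z, [/\ cmod (z - z0) < del, Q.[z] != 0 & ratfun P Q z = w].
Proof.
move=> Q0 S0 del0; set S := P - _ in S0.
have [m [T T0 ST]] := multiplicity_XsubC S z0; rewrite S0 /= in T0.
have [d1 d10 H1] := horner_neq0_near T0.
have [d2 d20 H2] := horner_neq0_near Q0.
have [d3 d30 H3] := @ccont_horner setT Q z0 1 ltr01.
pose d := Num.min del (Num.min d1 (Num.min d2 d3)) / 2.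
have dd : 0 < d by rewrite divr_gt0 // !lt_min del0 d10 d20.
have /andP[ddel /andP[dd1 /andP[dd2 dd3]]] : [&& d < del, d < d1, d < d2 & d < d3].
  by rewrite -!lt_min /d ltr_pdivrMr // ltr_pMr ?ltr1n // !lt_min del0 d10 d20.
have Tz0 : 0 < cmod T.[z0] by rewrite cmod_gt0.
pose B := cmod Q.[z0] + 1.
have B0 : 0 < B by have := cmod_ge0 Q.[z0]; rewrite /B; lra.
(* On the circle of radius [d]: the power contributes [d ^+ m], the cofactor [T] at least half its
   value at [z0], and the denominator at most [B]. *)
pose c := d ^+ m * (cmod T.[z0] / 2) / B.
have c0 : 0 < c by rewrite !divr_gt0 // mulr_gt0 ?exprn_gt0 // divr_gt0.
have Qn z : cmod (z - z0) <= d -> Q.[z] != 0.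
  move=> hz; rewrite -cmod_gt0; apply: lt_trans (H2 z (le_lt_trans hz dd2)).
  by rewrite divr_gt0 // cmod_gt0.
exists (c / 2); first by rewrite divr_gt0.
move=> w hw; have [||z hz zE] := @open_mapping R (ratfun P Q) z0 d c dd c0 _ _ w hw.
- by move=> z /Qn; exact: derC_ratfun.
- move=> z zd; have zd' : cmod (z - z0) <= d by rewrite zd.
  have -> : ratfun P Q z - ratfun P Q z0 = S.[z] / Q.[z].
    by rewrite /S !hornerE mulrBl mulfK ?Qn.
  rewrite ST !hornerE cmodM cmodV cmodM cmodX zd /c.
  have h1 := H1 z (le_lt_trans zd' dd1).
  have h3 := H3 z I (le_lt_trans zd' dd3).
  have QB : cmod Q.[z] <= B by rewrite /B; have := cmod_rtri Q.[z] Q.[z0]; lra.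
  rewrite [cmod T.[z] * _]mulrC; apply: ler_pM.
  + by apply: mulr_ge0; [exact/ltW/exprn_gt0|exact/ltW/divr_gt0].
  + by rewrite invr_ge0; exact: ltW.
  + by rewrite ler_pM2l ?exprn_gt0 // ltW.
  + by rewrite lef_pV2 ?posrE ?cmod_gt0 ?Qn.
by exists z; split => //; [exact: lt_trans ddel|rewrite Qn // ltW].
Qed.

(** The only form of connectedness used: the disk and the collar are treated through explicit
    paths. *)
Lemma interval_induction (P : R -> Prop) : P 0 ->
  (forall s, 0 <= s <= 1 -> P s ->
     exists2 d : R, 0 < d & forall t, 0 <= t <= 1 -> `|t - s| < d -> P t) ->
  (forall s, 0 <= s <= 1 -> (forall d : R, 0 < d ->
     exists t, [/\ 0 <= t <= 1, `|t - s| < d & P t]) -> P s) ->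
  P 1.
Proof.
move=> P0 oP cP.
pose A : set R := [set s | 0 <= s <= 1 /\ forall t, 0 <= t <= s -> P t].
have A0 : A 0.
  by split; [rewrite lexx ler01|move=> t /le_anti <-].
have hs : has_sup A by split; [exists 0|exists 1 => s [/andP[]]].
pose s := sup A.
have s0 : 0 <= s by apply: ub_le_sup => //; case: hs.
have s1 : s <= 1 by apply: ge_sup => [|x [/andP[]]] //; exists 0.
have lts t : 0 <= t < s -> P t.
  move=> /andP[t0 ts]; have e0 : 0 < s - t by rewrite subr_gt0.
  have [x [_ hx] xs] := sup_adherent e0 hs.
  by apply: hx; rewrite t0 /=; move: xs; rewrite -/s; lra.
have s01 : 0 <= s <= 1 by rewrite s0.
have Ps : P s.
  have [->//|sn0] := eqVneq s 0.
  have sp : 0 < s by rewrite lt_def sn0.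
  apply: cP => // d d0; exists (Num.max 0 (s - d / 2)).
  have h1 : 0 <= Num.max 0 (s - d / 2) by rewrite le_max lexx.
  have h2 : Num.max 0 (s - d / 2) < s by rewrite gt_max sp /=; lra.
  have h3 : s - d / 2 <= Num.max 0 (s - d / 2) by rewrite le_max lexx orbT.
  split; [rewrite h1 /=; lra|rewrite ltr_norml; lra|apply: lts; rewrite h1 //].
have [d d0 Hd] := oP s s01 Ps.
have [->|sn1] := eqVneq 1 s; first exact: Ps.
have slt1 : s < 1 by rewrite lt_def sn1.
pose x := Num.min 1 (s + d / 2).
have x1 : x <= 1 by rewrite ge_min lexx.
have sx : s < x by rewrite lt_min slt1 /=; lra.
have xd : x <= s + d / 2 by rewrite ge_min lexx orbT.
have : A x.
  split; first by lra.
  move=> t /andP[t0 tx]; have [ts|st] := ltP t s; first by apply: lts; rewrite t0.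
  by apply: Hd; [lra|rewrite ltr_norml; lra].
move=> /(ub_le_sup (proj2 hs)); rewrite -/s; lra.
Qed.

End Rational.

(** * Convex combinations and bounds for radial points *)

Section Convexity.
Variable R : realFieldType.

Lemma convex_lt (s x y b : R) : 0 <= s <= 1 -> x < b -> y < b -> (1 - s) * x + s * y < b.
Proof.
move=> /andP[s0 s1] xb yb.
have [->|s1'] := eqVneq s 1; first by rewrite subrr mul0r add0r mul1r.
have : s < 1 by rewrite lt_def eq_sym s1'.
nra.
Qed.

Lemma convex_gt (s x y b : R) : 0 <= s <= 1 -> b < x -> b < y -> b < (1 - s) * x + s * y.
Proof.
move=> s01 bx yb; rewrite -ltrN2 opprD -!mulrN; apply: convex_lt => //; by rewrite ltrN2.
Qed.

Lemma shrink_bounds (r x : R) : 0 < r -> r < 1 -> 0 < x -> x <= 1 ->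
  r < 1 - (1 - r) / 2 * x /\ 1 - (1 - r) / 2 * x < 1.
Proof. by move=> r0 r1 x0 x1; split; nra. Qed.

End Convexity.

(** * The abstract matching argument: [F = k o chi] on the circle makes [F] constant *)

Section Core.
Variable R : realType.
Local Notation C := (Cplx R).
Implicit Types (z w u v : C).

Variables (P Q : {poly C}) (K V : set C) (k F : C -> C) (rho : R).
Local Notation chi := (ratfun P Q).

Hypothesis PQ0 : forall z, Q.[z] = 0 -> P.[z] != 0.
Hypothesis cK : eclosed K.
Hypothesis bK : ebounded K.
Hypothesis VK : V `<=` K.
Hypothesis oV : eopen V.
Hypothesis ck : forall v, K v -> ccont K k v.
Hypothesis dk : forall v, V v -> derivable k v 1.
Hypothesis cF : forall u, cmod u <= 1 -> ccont [set u | cmod u <= 1] F u.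
Hypothesis dF : forall u, cmod u < 1 -> derivable F u 1.
Hypothesis rho0 : 0 < rho.
Hypothesis rho1 : rho < 1.
Hypothesis Qann : forall u, rho < cmod u -> cmod u <= 1 -> Q.[u] != 0.
Hypothesis Vann : forall u, rho < cmod u -> cmod u < 1 -> V (chi u).
Hypothesis Kcirc : forall u, cmod u = 1 -> K (chi u) /\ ~ V (chi u).
Hypothesis circK : forall v, K v -> ~ V v -> exists2 t, cmod t = 1 & chi t = v.
Hypothesis chi_inj : forall u w, rho < cmod u -> cmod u < 1 -> rho < cmod w -> cmod w < 1 ->
  chi u = chi w -> u = w.
Hypothesis chi_ext : forall u, 1 <= cmod u -> Q.[u] != 0 -> ~ V (chi u).
Hypothesis Fk : forall u, cmod u = 1 -> F u = k (chi u).
Hypothesis pole : exists2 u, cmod u < 1 & Q.[u] = 0.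

Definition admissible z := [/\ cmod z < 1, Q.[z] != 0 & V (chi z)].

Lemma admissible_open z : admissible z ->
  exists2 r : R, 0 < r & forall w, cmod (w - z) < r -> admissible w.
Proof.
move=> [z1 Qz Vz].
have [d1 d10 H1] := horner_neq0_near Qz.
have [e e0 He] := oV Vz.
have [d2 d20 H2] := @ccont_ratfun _ setT P Q z Qz e e0.
exists (Num.min (1 - cmod z) (Num.min d1 d2)); first by rewrite !lt_min subr_gt0 z1 d10.
move=> w; rewrite !lt_min => /andP[h0 /andP[h1 h2]]; split.
- by have := cmod_rtri w z; lra.
- by rewrite -cmod_gt0; apply: lt_trans (H1 w h1); rewrite divr_gt0 // cmod_gt0.
- by apply: He; exact: H2.
Qed.

Lemma admissible_der z : admissible z -> derivable (fun u => F u - k (chi u)) z 1.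
Proof.
move=> [z1 Qz Vz].
apply: (@derC_sub _ F (fun u => k (chi u)) z (dF z1)).
exact: (@derivable_compC _ chi k z (@derC_ratfun _ P Q z Qz) (dk Vz)).
Qed.

(* Working with this set rather than with a connected component of [chi^-1 V]
   spares the theory of components. *)
Definition agree z := admissible z /\
  exists2 r : R, 0 < r & forall w, cmod (w - z) < r -> F w = k (chi w).

Lemma agree_eq z : agree z -> F z = k (chi z).
Proof. by move=> [_ [r r0 H]]; apply: H; rewrite subrr cmod0. Qed.

Lemma agree_open z : agree z -> exists2 r : R, 0 < r & forall w, cmod (w - z) < r -> agree w.
Proof.
move=> [/admissible_open[r1 r10 H1] [r2 r20 H2]].
exists (Num.min r1 r2); first by rewrite lt_min r10.
move=> w; rewrite lt_min => /andP[h1 h2]; split; first exact: H1.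
exists (r2 - cmod (w - z)); first by rewrite subr_gt0.
by move=> v hv; apply: H2; have := cmod_tri v z w; lra.
Qed.

Definition agree_cl z := forall e : R, 0 < e -> exists2 w, agree w & cmod (w - z) < e.

Lemma shell_closed (c : C) (a b : R) : eclosed [set z | a <= cmod (z - c) <= b].
Proof.
move=> z Hz /=; rewrite !leNgt; apply/andP; split; apply/negP => h.
  have [|w /= /andP[w1 w2] hw] := Hz (a - cmod (z - c)); first by rewrite subr_gt0.
  by have := cmod_tri w c z; lra.
have [|w /= /andP[w1 w2] hw] := Hz (cmod (z - c) - b); first by rewrite subr_gt0.
by have := cmod_tri z c w; rewrite (cmodB z w); lra.
Qed.

Lemma shell_bounded (c : C) (a b : R) : ebounded [set z | a <= cmod (z - c) <= b].
Proof. by exists (b + cmod c) => z /= /andP[_ h]; have := cmod_rtri z c; lra. Qed.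

Lemma shell_open (c : C) (a b : R) : eopen [set z | a < cmod (z - c) < b].
Proof.
move=> z /= /andP[h1 h2]; exists (Num.min (cmod (z - c) - a) (b - cmod (z - c))).
  by rewrite lt_min !subr_gt0 h1.
move=> w; rewrite lt_min => /andP[k1 k2]; apply/andP; split.
  by have := cmod_tri z c w; rewrite (cmodB z w); lra.
by have := cmod_tri w c z; lra.
Qed.

Lemma shell_sub (c : C) (a b : R) :
  [set z | a < cmod (z - c) < b] `<=` [set z | a <= cmod (z - c) <= b].
Proof. by move=> z /= /andP[h1 h2]; rewrite !ltW. Qed.

(** The local step of the identity theorem. Agreement on a small disk around [w] spreads to a larger
    one: on an annulus around [w] the difference vanishes on the inner circle, while [1 / (u - w)]
    is smallest on the outer one, so [vanishing] applies. *)
Lemma agree_closed z : admissible z -> agree_cl z -> agree z.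
Proof.
move=> gz clz; split => //.
have [r r0 Hr] := admissible_open gz.
(* The disk of radius [2 * d] around [w] then stays within [3 * d < r] of [z], hence among
   admissible points. *)
pose d := r / 4; have d0 : 0 < d by rewrite divr_gt0.
have [w [gw [s s0 Hs]] wz] := clz d d0.
exists d => // v vz.
have vw : cmod (v - w) < 2 * d by have := cmod_tri v w z; rewrite (cmodB z w); lra.
have [vs|sv] := ltP (cmod (v - w)) s; first exact: Hs.
pose a := s / 2.
have a0 : 0 < a by rewrite divr_gt0.
have inadm u : a <= cmod (u - w) <= 2 * d -> admissible u.
  move=> /andP[_ h]; apply: Hr; have := cmod_tri u z w; rewrite /d in h wz *; lra.
have einv u : a <= cmod (u - w) <= 2 * d -> derivable (fun x => (x - w)^-1) u 1.
  move=> /andP[h _]; apply: (@derC_inv _ (fun x => x - w)).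
    by rewrite -cmod_gt0; exact: lt_le_trans h.
  exact: (@derC_sub _ (fun x => x) (fun _ => w) u (@derC_id _ u) (@derC_cst _ w u)).
apply/eqP; rewrite -subr_eq0; apply/eqP.
apply: (@vanishing R [set u | a <= cmod (u - w) <= 2 * d] [set u | a < cmod (u - w) < 2 * d]
  (fun u => F u - k (chi u)) (fun u => (u - w)^-1) (2 * d)^-1).
- exact: shell_closed.
- exact: shell_bounded.
- exact: shell_sub.
- exact: shell_open.
- by rewrite invr_ge0; lra.
- by move=> u /inadm h; apply: derivable_ccont; exact: admissible_der.
- by move=> u /shell_sub /inadm; exact: admissible_der.
- by move=> u /einv h; apply: derivable_ccont; exact: h.
- by move=> u /shell_sub /einv.
- move=> u /= /andP[h1 h2] /negP; rewrite negb_and -!leNgt => /orP[h|h].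
    by left; rewrite Hs ?subrr //; rewrite /a in h; lra.
  by right; rewrite cmodV lef_pV2 ?posrE; lra.
- by rewrite /= (ltW vw) andbT /a; lra.
- by rewrite cmodV ltf_pV2 ?posrE //; lra.
Qed.

(** [vanishing] with the identity as auxiliary function: the difference is zero on the unit circle,
    and on the inner circle of radius [a] the modulus is below [cmod u]. *)
Lemma annulus_eq u : rho < cmod u -> cmod u <= 1 -> F u = k (chi u).
Proof.
move=> ru u1; pose a := (rho + cmod u) / 2.
have ra : rho < a by rewrite /a; lra.
apply/eqP; rewrite -subr_eq0; apply/eqP.
have Kchi w : a <= cmod (w - 0) <= 1 -> K (chi w).
  rewrite subr0 => /andP[h1 h2]; have [w1|w1] := ltP (cmod w) 1.
    by apply/VK/Vann => //; exact: lt_le_trans h1.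
  by case: (@Kcirc w) => //; apply/eqP; rewrite eq_le h2.
apply: (@vanishing R [set w | a <= cmod (w - 0) <= 1] [set w | a < cmod (w - 0) < 1]
  (fun u => F u - k (chi u)) (fun u => u) a).
- exact: shell_closed.
- exact: shell_bounded.
- exact: shell_sub.
- exact: shell_open.
- exact: ltW (lt_trans rho0 ra).
- move=> w hw; apply: ccont_sub.
    apply: (@ccontS _ _ [set u | cmod u <= 1]); first by move=> v /=; rewrite subr0 => /andP[].
    by apply: cF; move: hw => /=; rewrite subr0 => /andP[].
  apply: (@ccont_comp _ _ K); [|exact: Kchi|exact/ck/Kchi].
  move: hw => /=; rewrite subr0 => /andP[h1 h2].
  by apply/ccont_ratfun/Qann => //; exact: lt_le_trans h1.
- move=> w /=; rewrite subr0 => /andP[h1 h2]; apply: admissible_der; split => //.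
    by apply: Qann; [exact: lt_trans h1|exact: ltW].
  by apply: Vann => //; exact: lt_trans h1.
- by move=> w _; apply: derivable_ccont; exact: derC_id.
- by move=> w _; exact: derC_id.
- move=> w /=; rewrite subr0 => /andP[h1 h2] /negP; rewrite negb_and -!leNgt => /orP[h|h].
    by right.
  by left; rewrite Fk ?subrr //; apply/eqP; rewrite eq_le h2.
- by rewrite /= subr0 u1 andbT /a; lra.
- by rewrite /a; lra.
Qed.

Lemma annulus_agree u : rho < cmod u -> cmod u < 1 -> agree u.
Proof.
move=> h1 h2; split.
  by split => //; [apply: Qann => //; exact: ltW|exact: Vann].
exists (Num.min (cmod u - rho) (1 - cmod u)); first by rewrite lt_min !subr_gt0 h1.
move=> w; rewrite lt_min => /andP[k1 k2]; apply: annulus_eq.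
  by have := cmod_rtri u w; rewrite cmodB; lra.
by have := cmod_rtri w u; lra.
Qed.

(** Near a pole [chi] is unbounded, whereas at agreeing points it stays in the bounded set [K]; so
    limits of such points are not poles. *)
Lemma agree_cl_K z : agree_cl z -> Q.[z] != 0 /\ K (chi z).
Proof.
move=> clz; have [M HM] := bK.
have Q0 : Q.[z] != 0.
  apply/eqP => Qz; have := PQ0 Qz; rewrite -cmod_gt0 ltNge => /negP; apply.
  have M0 : 0 <= M.
    by have [w [[_ _ Vw] _] _] := clz 1 ltr01; apply: le_trans (HM _ (VK Vw)); exact: cmod_ge0.
  apply: (@le0_eps _ _ (M + 1)) => e e0.
  have [d1 d10 H1] := @ccont_horner _ setT P z e e0.
  have [d2 d20 H2] := @ccont_horner _ setT Q z e e0.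
  have [|w [[_ Qw Vw] _]] := clz (Num.min d1 d2); first by rewrite lt_min d10.
  rewrite lt_min => /andP[/(H1 w I) h1 /(H2 w I) h2].
  have := HM _ (VK Vw); rewrite /ratfun cmodM cmodV ler_pdivrMr ?cmod_gt0 // => h.
  rewrite Qz subr0 in h2; have := cmod_rtri P.[z] P.[w]; rewrite cmodB.
  have : M * cmod Q.[w] <= M * e by rewrite ler_wpM2l // ltW.
  by lra.
split => //; apply: cK => e e0.
have [d d0 Hd] := @ccont_ratfun _ setT P Q z Q0 e e0.
have [w [[_ _ Vw] _] hw] := clz d d0.
by exists (chi w); [exact: VK|exact: Hd].
Qed.

(** Follow the segment from a collar point to the pole. Without an exit, agreement would persist up
    to the pole, which is not admissible. *)
Lemma exit_point : exists b, [/\ cmod b <= rho, Q.[b] != 0, K (chi b), ~ V (chi b) & agree_cl b].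
Proof.
have h0 := rho0; have h1 := rho1.
apply: contrapT => no; have [us us1 Qus] := pole.
pose u1 := cR ((1 + rho) / 2).
have u1m : cmod u1 = (1 + rho) / 2 by rewrite cmod_cR ger0_norm //; lra.
clearbody u1; pose p (s : R) := u1 + cR s * (us - u1).
have p1 s : 0 <= s <= 1 -> cmod (p s) < 1.
  move=> /andP[s0 s1].
  have -> : p s = cR (1 - s) * u1 + cR s * us by rewrite /p cRD cRN cR1; ring.
  apply: le_lt_trans (cmodD _ _) _; rewrite !cmodM !cmod_cR !ger0_norm ?subr_ge0 // u1m.
  by apply: convex_lt => //; [rewrite s0|lra].
have pd s t : cmod (p t - p s) = `|t - s| * cmod (us - u1).
  have -> : p t - p s = cR (t - s) * (us - u1) by rewrite /p cRD cRN; ring.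
  by rewrite cmodM cmod_cR.
pose L := cmod (us - u1) + 1.
have L0 : 0 < L by rewrite /L; have := cmod_ge0 (us - u1); lra.
have pL s t (e : R) : `|t - s| < e / L -> cmod (p t - p s) < e.
  rewrite ltr_pdivlMr // => h; rewrite pd; apply: le_lt_trans h.
  by rewrite ler_wpM2l // /L; lra.
suff : agree (p 1).
  rewrite /p cR1 mul1r addrC subrK => -[[_ + _] _]; by rewrite Qus eqxx.
apply: (@interval_induction R (fun s => agree (p s))).
- by rewrite /p cR0 mul0r addr0; apply: annulus_agree; rewrite u1m; lra.
- move=> s hs /agree_open[r r0 Hr]; exists (r / L); first by rewrite divr_gt0.
  by move=> t ht /pL /Hr.
- move=> s hs Hs.
  have clp : agree_cl (p s).
    move=> e e0; have [|t [ht hts Wt]] := Hs (e / L); first by rewrite divr_gt0.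
    by exists (p t) => //; exact: pL.
  have [Qp Kp] := agree_cl_K clp.
  apply: agree_closed => //; split => //; first exact: p1.
  apply: contrapT => nV; apply: no; exists (p s); split => //.
  by rewrite leNgt; apply/negP => h; apply: nV; apply: Vann => //; exact: p1.
Qed.

Let rho' := (1 + rho) / 2.
Let rr' : rho < rho'. Proof. have := rho1; by rewrite /rho'; lra. Qed.
Let r'1 : rho' < 1. Proof. have := rho1; by rewrite /rho'; lra. Qed.
Let rp0 : 0 < rho'. Proof. exact: lt_trans rho0 rr'. Qed.
Let Yann u := rho' < cmod u /\ cmod u < 1.
(** The non-strict bound survives limits, and injectivity of [chi] on the collar makes it strict
    when [u] lies in [Yann]; this is what lets the property be both closed and open. *)
Definition covered u := exists z, [/\ agree z, cmod z <= (1 + rho) / 2 & chi z = chi u].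

Lemma chi_nonconst v : P - v%:P * Q != 0.
Proof.
have [us us1 Qus] := pole; apply/eqP => h.
have : (P - v%:P * Q).[us] = 0 by rewrite h horner0.
rewrite !hornerE Qus mulr0 subr0; exact/eqP/PQ0.
Qed.

(** The exit point [b] shares its value with some [t] on the circle. For an agreeing [w] close to
    [b], openness of [chi] at [t] gives [u] near [t] with the same value; as this value is in [V],
    [u] lies inside the disk. *)
Lemma covered_nonempty : exists2 u, Yann u & covered u.
Proof.
have rh0 := rho0; have rh1 := rho1; have rq1 := rr'; have rq2 := r'1; have rq3 := rp0.
have [b [brho Qb Kb nVb clb]] := exit_point.
have [t t1 tb] := circK Kb nVb.
have Qt : Q.[t] != 0 by apply: Qann; rewrite t1.
have [|eta eta0 Heta] := ratfun_open Qt (chi_nonconst (chi t)) (_ : 0 < 1 - rho').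
  by rewrite subr_gt0.
have [d d0 Hd] := @ccont_ratfun _ setT P Q b Qb eta eta0.
have [|w Ww] := clb (Num.min d (rho' - rho)); first by rewrite lt_min d0 subr_gt0.
rewrite lt_min => /andP[wd wr].
have := Heta (chi w); rewrite tb => /(_ (Hd w I wd)) [u [ut Qu uw]].
have Vu : V (chi u) by rewrite uw; case: Ww => -[].
have u1 : cmod u < 1.
  by rewrite ltNge; apply/negP => h; exact: (chi_ext h Qu Vu).
exists u; first by split => //; have := cmod_rtri t u; rewrite cmodB t1; lra.
exists w; split => //; have := cmod_rtri w b; rewrite -/rho'; lra.
Qed.

(** A preimage [z] of modulus exactly [rho'] would lie in the injective collar and equal [u], which
    is impossible; so there is room around [z] to apply openness of [chi]. *)
Lemma covered_open u : Yann u -> covered u ->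
  exists2 d : R, 0 < d & forall w, Yann w -> cmod (w - u) < d -> covered w.
Proof.
have rh0 := rho0; have rh1 := rho1; have rq1 := rr'; have rq2 := r'1; have rq3 := rp0.
move=> [u1 u2] [z [Wz zr zu]].
have zr' : cmod z < rho'.
  rewrite lt_neqAle zr andbT; apply/eqP => zE.
  have zuE : z = u by apply: chi_inj => //; rewrite ?zE //; exact: lt_trans u1.
  by move: u1; rewrite -zuE zE ltxx.
have [r r0 Hr] := agree_open Wz.
have Qz : Q.[z] != 0 by case: Wz => -[].
have [|eta eta0 Heta] := ratfun_open Qz (chi_nonconst (chi z)) (_ : 0 < Num.min r (rho' - cmod z)).
  by rewrite lt_min r0 subr_gt0.
have Qu : Q.[u] != 0 by apply: Qann; [exact: lt_trans u1|exact: ltW].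
have [d d0 Hd] := @ccont_ratfun _ setT P Q u Qu eta eta0.
exists d => // w _ hw.
have := Heta (chi w); rewrite zu => /(_ (Hd w I hw)) [x [+ Qx xw]].
rewrite lt_min => /andP[xr xz]; exists x; split => //; first exact: Hr.
by rewrite -/rho'; have := cmod_rtri x z; lra.
Qed.

(** Here [u] may lie on the unit circle. The sequence [zn] is part of the conclusion because
    [interior_max] passes to the limit in [F (zn n) = F (un n)]. *)
Lemma covered_limit (un : nat -> C) u : cmod u <= 1 -> rho < cmod u ->
  (forall n, covered (un n)) ->
  (forall e : R, 0 < e -> exists N : nat, forall n, (N <= n)%N -> cmod (un n - u) < e) ->
  exists zn : nat -> C, exists z, [/\
    forall n, [/\ agree (zn n), cmod (zn n) <= rho' & chi (zn n) = chi (un n)],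
    forall e : R, 0 < e -> forall N : nat, exists2 n, (N <= n)%N & cmod (zn n - z) < e,
    cmod z <= rho', agree_cl z & chi z = chi u].
Proof.
have rh0 := rho0; have rh1 := rho1; have rq1 := rr'; have rq2 := r'1; have rq3 := rp0.
move=> u1 ru Sn lim.
have [zn Hzn] := choice Sn.
have [z Hz] := @bolzano_weierstrassC R zn rho' (fun n => let: And3 _ h _ := Hzn n in h).
have zr : cmod z <= rho'.
  rewrite -subr_le0; apply: (@le0_eps _ _ 1) => e e0; rewrite mulr1.
  have [n _ hn] := Hz e e0 0%N; have [_ h _] := Hzn n.
  by have := cmod_rtri z (zn n); rewrite cmodB -/rho' in h *; lra.
have clz : agree_cl z.
  by move=> e e0; have [n _ hn] := Hz e e0 0%N; exists (zn n) => //; case: (Hzn n).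
have [Qz Kz] := agree_cl_K clz.
exists zn, z; split => //.
have Qu : Q.[u] != 0 by exact: Qann.
apply/eqP; rewrite -subr_eq0 -cmod_eq0 eq_le cmod_ge0 andbT.
apply: (@le0_eps _ _ 2) => e e0.
have [d1 d10 H1] := @ccont_ratfun _ setT P Q z Qz e e0.
have [d2 d20 H2] := @ccont_ratfun _ setT P Q u Qu e e0.
have [N HN] := lim _ d20; have [n Nn hn] := Hz _ d10 N.
have h1 := H1 _ I hn; have h2 := H2 _ I (HN n Nn).
have [_ _ zE] := Hzn n; rewrite zE in h1.
have := cmod_tri (chi z) (chi u) (chi (un n)); rewrite (cmodB (chi z) (chi (un n))); lra.
Qed.

Lemma inv_small (e : R) : 0 < e -> exists N : nat, forall n, (N <= n)%N -> (n.+1%:R : R)^-1 < e.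
Proof.
move=> e0; exists (Num.Def.archi_bound e^-1) => n Nn.
rewrite invf_plt ?posrE //; apply: lt_trans (archi_boundP _) _; first by rewrite ltW // invr_gt0.
by rewrite ltr_nat ltnS.
Qed.

Lemma covered_closed u : Yann u ->
  (forall d : R, 0 < d -> exists2 w, covered w & cmod (w - u) < d) -> covered u.
Proof.
have rh0 := rho0; have rh1 := rho1; have rq1 := rr'; have rq2 := r'1; have rq3 := rp0.
move=> [u1 u2] Hu.
have [un Hun] : {un : nat -> C & forall n, covered (un n) /\ cmod (un n - u) < n.+1%:R^-1}.
  apply: (@choice _ _ (fun (n : nat) w => covered w /\ cmod (w - u) < n.+1%:R^-1)) => n.
  by have [|w Sw hw] := Hu (n.+1%:R^-1); [rewrite invr_gt0|exists w].
have [|||e e0|zn [z [_ _ zr clz zu]]] := @covered_limit un u.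
- exact: ltW.
- exact: lt_trans u1.
- by move=> n; case: (Hun n).
- have [N HN] := inv_small e0; exists N => n /HN h; apply: lt_trans h; by case: (Hun n).
have [Qz _] := agree_cl_K clz.
exists z; split => //; apply: agree_closed => //; split => //; first exact: le_lt_trans r'1.
by rewrite zu; apply: Vann => //; exact: lt_trans u1.
Qed.

Lemma covered_all u : Yann u -> covered u.
Proof.
have rh0 := rho0; have rh1 := rho1; have rq1 := rr'; have rq2 := r'1; have rq3 := rp0.
move=> Yu; have [u0 Yu0 Su0] := covered_nonempty.
have nz w : Yann w -> w != 0.
  by move=> [w1 _]; rewrite -cmod_gt0; apply: lt_trans w1; lra.
have [t0 E0] := cexp_surj (nz _ Yu0); have [t1 E1] := cexp_surj (nz _ Yu).
set a0 := mkC _ t0 in E0; set a1 := mkC _ t1 in E1.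
(* A segment between logarithms: the modulus interpolates geometrically, so the path never leaves
   the collar. *)
pose p (s : R) := cexp (a0 + cR s * (a1 - a0)).
have rp := rp0.
have Yp s : 0 <= s <= 1 -> Yann (p s).
  move=> /andP[s0 s1].
  have -> : p s = cexp (mkC ((1 - s) * ln (cmod u0) + s * ln (cmod u))
      (imC (a0 + cR s * (a1 - a0)))).
    rewrite /p; congr cexp; rewrite [LHS]mkC_eta; congr mkC.
    by rewrite !(reCD, reCM, reCN) /a0 /a1 /=; ring.
  case: Yu Yu0 => y1 y2 [y3 y4]; rewrite /Yann cmod_cexp reC_mk.
  have l1 : ln rho' < ln (cmod u) by rewrite ltr_ln ?posrE //; exact: lt_trans y1.
  have l2 : ln rho' < ln (cmod u0) by rewrite ltr_ln ?posrE //; exact: lt_trans y3.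
  have l3 : ln (cmod u) < 0 by rewrite -ln1 ltr_ln ?posrE //; exact: lt_trans y1.
  have l4 : ln (cmod u0) < 0 by rewrite -ln1 ltr_ln ?posrE //; exact: lt_trans y3.
  split.
    rewrite -{1}(lnK (x := rho')) ?posrE // ltr_expR.
    by apply: convex_gt => //; rewrite s0.
  by rewrite expR_lt1; apply: convex_lt => //; rewrite s0.
have cp s (e : R) : 0 < e -> exists2 d : R, 0 < d & forall t, `|t - s| < d -> cmod (p t - p s) < e.
  move=> e0; have [d d0 Hd] := derivable_ccont setT (@derivable_cexp _ (a0 + cR s * (a1 - a0))) e0.
  have L0 : 0 < cmod (a1 - a0) + 1 by have := cmod_ge0 (a1 - a0); lra.
  exists (d / (cmod (a1 - a0) + 1)); first by rewrite divr_gt0.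
  move=> t; rewrite ltr_pdivlMr // => h; apply: Hd => //.
  have -> : a0 + cR t * (a1 - a0) - (a0 + cR s * (a1 - a0)) = cR (t - s) * (a1 - a0).
    by rewrite cRD cRN; ring.
  rewrite cmodM cmod_cR; apply: le_lt_trans h; rewrite ler_wpM2l //; lra.
have -> : u = p 1 by rewrite E1 /p cR1 mul1r addrC subrK.
apply: (@interval_induction R (fun s => covered (p s))).
- by rewrite /p cR0 mul0r addr0 -E0.
- move=> s hs /(covered_open (Yp _ hs))[d d0 Hd]; have [d' d'0 Hd'] := cp s d d0.
  by exists d' => // t ht /Hd' h; apply: Hd => //; exact: Yp.
- move=> s hs Hs; apply: covered_closed; first exact: Yp.
  move=> d d0; have [d' d'0 Hd'] := cp s d d0; have [t [ht hts St]] := Hs _ d'0.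
  by exists (p t) => //; exact: Hd'.
Qed.

(** If the maximum is at [m] on the circle, approach [m] radially. The second preimages of the
    values of [chi] accumulate at a point of modulus at most [rho'], where [F] equals [F m]. *)
Lemma interior_max : exists2 z, cmod z < 1 & forall u, cmod u <= 1 -> cmod (F u) <= cmod (F z).
Proof.
have rh0 := rho0; have rh1 := rho1; have rq1 := rr'; have rq2 := r'1; have rq3 := rp0.
have D0 : [set u : C | cmod u <= 1] 0 by rewrite /= cmod0 ler01.
have [||m m1 Hm] := @compact_max_modulus R [set u | cmod u <= 1] F 0 D0 _ _ cF.
- by move=> z Hz; rewrite /= -subr_le0; apply: (@le0_eps _ _ 1) => e /Hz[w /= w1 hw];
    rewrite mulr1; have := cmod_rtri z w; rewrite cmodB; lra.
- by exists 1.
have [mlt|mge] := ltP (cmod m) 1; first by exists m.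
have mE : cmod m = 1 by apply/eqP; rewrite eq_le m1.
pose un (n : nat) := cR (1 - (1 - rho') / 2 * n.+1%:R^-1) * m.
have dn (n : nat) : cmod (un n - m) = (1 - rho') / 2 * n.+1%:R^-1.
  have -> : un n - m = - cR ((1 - rho') / 2 * n.+1%:R^-1) * m by rewrite /un cRD cRN cR1; ring.
  by rewrite cmodM mE mulr1 cmodN cmod_cR ger0_norm // mulr_ge0 ?invr_ge0 //; lra.
have n1 (n : nat) : 0 < (n.+1%:R : R)^-1 <= 1.
  by rewrite invr_gt0 ltr0n /= invf_le1 // ler1n.
have Yn n : Yann (un n).
  have /andP[a1 a2] := n1 n.
  have cu : cmod (un n) = 1 - (1 - rho') / 2 * n.+1%:R^-1.
    rewrite /un cmodM mE mulr1 cmod_cR gtr0_norm //.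
    exact: lt_trans rq3 (shrink_bounds rq3 rq2 a1 a2).1.
  by rewrite /Yann cu; exact: shrink_bounds.
have lim (e : R) : 0 < e -> exists N : nat, forall n, (N <= n)%N -> cmod (un n - m) < e.
  move=> e0; have [N HN] := inv_small e0; exists N => n /HN h; rewrite dn.
  have /andP[a1 a2] := n1 n; apply: le_lt_trans h.
  by rewrite ler_piMl ?(ltW a1) //; lra.
have [||zn [z [Hzn Hz zr _ _]]] := @covered_limit un m _ _ (fun n => covered_all (Yn n)) lim.
- by rewrite mE.
- by rewrite mE.
have z1 : cmod z < 1 := le_lt_trans zr r'1.
exists z => // u u1; suff -> : F z = F m by exact: Hm.
apply/eqP; rewrite -subr_eq0 -cmod_eq0 eq_le cmod_ge0 andbT.
apply: (@le0_eps _ _ 2) => e e0.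
have [d1 d10 H1] := cF (ltW z1) e0; have [d2 d20 H2] := cF m1 e0.
have [N HN] := lim _ d20; have [n Nn hn] := Hz _ d10 N.
have [Wn znr zE] := Hzn n.
have [y1 y2] := Yn n.
have h1 := H1 (zn n) (ltW (le_lt_trans znr r'1)) hn.
have h2 := H2 (un n) (ltW y2) (HN n Nn).
have FE : F (zn n) = F (un n).
  by rewrite (agree_eq Wn) zE -annulus_eq ?ltW //; exact: lt_trans y1.
rewrite FE in h1.
have := cmod_tri (F z) (F m) (F (un n)); rewrite (cmodB (F z) (F (un n))); lra.
Qed.

(** The value at an interior maximum propagates along segments in the disk by [strong_max], then to
    the circle by continuity. *)
Lemma matching_const : exists c, forall u, cmod u <= 1 -> F u = c.
Proof.
have [z z1 Hz] := interior_max; exists (F z).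
have lin u : cmod u < 1 -> F u = F z.
  move=> u1; pose p (s : R) := z + cR s * (u - z).
  have p1 s : 0 <= s <= 1 -> cmod (p s) < 1.
    move=> /andP[s0 s1].
    have -> : p s = cR (1 - s) * z + cR s * u by rewrite /p cRD cRN cR1; ring.
    apply: le_lt_trans (cmodD _ _) _; rewrite !cmodM !cmod_cR !ger0_norm ?subr_ge0 //.
    by apply: convex_lt => //; rewrite s0.
  pose L := cmod (u - z) + 1.
  have L0 : 0 < L by rewrite /L; have := cmod_ge0 (u - z); lra.
  have pL s t (e : R) : `|t - s| < e / L -> cmod (p t - p s) < e.
    rewrite ltr_pdivlMr // => h; apply: le_lt_trans h.
    have -> : p t - p s = cR (t - s) * (u - z) by rewrite /p cRD cRN; ring.
    by rewrite cmodM cmod_cR ler_wpM2l // /L; lra.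
  have -> : u = p 1 by rewrite /p cR1 mul1r addrC subrK.
  apply: (@interval_induction R (fun s => F (p s) = F z)).
  - by rewrite /p cR0 mul0r addr0.
  - move=> s hs Fs; have ps := p1 s hs.
    exists ((1 - cmod (p s)) / L); first by rewrite divr_gt0 // subr_gt0.
    move=> t ht /pL h; rewrite -Fs.
    have inD w : cmod (w - p s) < 1 - cmod (p s) -> cmod w < 1.
      by move=> hw; have := cmod_rtri w (p s); lra.
    apply: (@strong_max R F (p s) (1 - cmod (p s))) => // w /inD hw; first exact: dF.
    by rewrite Fs Hz // ltW.
  - move=> s hs Hs; have ps := p1 s hs.
    apply/eqP; rewrite -subr_eq0 -cmod_eq0 eq_le cmod_ge0 andbT.
    apply: (@le0_eps _ _ 1) => e e0; rewrite mulr1.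
    have [d d0 Hd] := cF (ltW ps) e0.
    have [|t [ht hts Ft]] := Hs (d / L); first by rewrite divr_gt0.
    by rewrite -Ft cmodB ltW // Hd ?pL //= ltW // p1.
move=> u u1; have [ult|uge] := ltP (cmod u) 1; first exact: lin.
apply/eqP; rewrite -subr_eq0 -cmod_eq0 eq_le cmod_ge0 andbT.
apply: (@le0_eps _ _ 1) => e e0; rewrite mulr1.
have [d d0 Hd] := cF u1 e0.
pose x := Num.min (d / 2) (1 / 2).
have x0 : 0 < x by rewrite lt_min !divr_gt0.
have xd : x < d by rewrite gt_min; apply/orP; left; lra.
have x2 : x <= 1 / 2 by rewrite ge_min lexx orbT.
pose w := cR (1 - x) * u.
have w1 : cmod w < 1.
  by rewrite cmodM cmod_cR ger0_norm; last lra; nra.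
have wu : cmod (w - u) < d.
  have -> : w - u = - cR x * u by rewrite /w cRD cRN cR1; ring.
  rewrite cmodM cmodN cmod_cR gtr0_norm //; nra.
by rewrite -(lin w w1) cmodB ltW // Hd //= ltW.
Qed.

End Core.

(** * Reversed polynomials and the Wronskian *)

Section ReversedPolynomial.
Variable K : numFieldType.

(** Reversal relative to a fixed [n], not to the size of [p]: numerator and denominator of [chi]
    then carry the same factor [u ^+ n]. *)
Definition rev_poly (n : nat) (p : {poly K}) : {poly K} := \poly_(i < n.+1) p`_(n - i).

Lemma rev_poly_horner n (p : {poly K}) (u : K) : (size p <= n.+1)%N -> u != 0 ->
  (rev_poly n p).[u] = u ^+ n * p.[u^-1].
Proof.
move=> sp u0; rewrite horner_poly (horner_coef_wide _ sp) mulr_sumr.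
rewrite (reindex_inj rev_ord_inj) /=; apply: eq_bigr => i _.
have lei : (i <= n)%N by rewrite -ltnS.
rewrite subSS subKn // mulrCA; congr (_ * _).
by rewrite exprVn -expfB_cond // (negPf u0) add0n.
Qed.

Lemma rev_poly0 n (p : {poly K}) : (rev_poly n p).[0] = p`_n.
Proof. by rewrite horner_coef0 coef_poly /= subn0. Qed.

Lemma deriv_eq0_size (p : {poly K}) : p^`() = 0 -> (size p <= 1)%N.
Proof.
move=> p0; apply/leq_sizeP => -[//|j] _.
have := congr1 (fun q : {poly K} => q`_j) p0; rewrite coef_deriv coef0 => /eqP.
by rewrite mulrn_eq0 => /orP[//|/eqP].
Qed.

(* The numerator of the derivative of [p / q]. *)
Lemma wronskian_neq0 (p q : {poly K}) : q != 0 -> coprimep p q ->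
  (0 < maxn (size p).-1 (size q).-1)%N -> p^`() * q - p * q^`() != 0.
Proof.
move=> q0 cpq deg; apply/eqP => /eqP; rewrite subr_eq0 => /eqP W0.
have qq' : q %| q^`().
  have cqp : coprimep q p by rewrite coprimep_sym.
  by rewrite -(Gauss_dvdpr _ cqp) -W0; exact: dvdp_mull.
have q'0 : q^`() = 0.
  apply/eqP; apply: contraT => nz; have := dvdp_leq nz qq'.
  by rewrite leqNgt lt_size_deriv.
have p'0 : p^`() = 0.
  by apply/eqP; move/eqP: W0; rewrite q'0 mulr0 mulf_eq0 (negPf q0) orbF.
have := deriv_eq0_size q'0; have := deriv_eq0_size p'0.
by move: deg; case: (size p) => [|[|?]]; case: (size q) => [|[|?]].
Qed.

End ReversedPolynomial.

(** * Conjugation on both sides preserves holomorphy *)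

Section DerivableConj.
Variable R : realType.
Local Notation C := (Cplx R).

Lemma derC_conj (f : C -> C) (z : C) : derivable f (Num.conj z) 1 ->
  derivable (fun u => Num.conj (f (Num.conj u))) z 1.
Proof.
move=> /derivableCP[d H]; apply/derivableCP; exists (Num.conj d) => e e0.
have [r r0 Hr] := H e e0; exists r => // h hr.
have := Hr (Num.conj h); rewrite cmod_conj => /(_ hr).
rewrite -(cmod_conj (_ - _ - _)) !rmorphB /= rmorphM /= conjCK.
by rewrite rmorphD /=.
Qed.

Lemma inv_ccont (K : set C) (w0 c : C) : c != 0 -> ccont K (fun v => w0 + v^-1) c.
Proof.
move=> c0; apply: derivable_ccont.
exact: (@derC_add _ (fun _ => w0) (fun v => v^-1) c (@derC_cst _ w0 c)
  (@derC_inv _ (fun v => v) c c0 (@derC_id _ c))).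
Qed.

End DerivableConj.

(** * The domain bounded by the image of the circle, and its coordinates *)

Section Domain.
Variable R : realType.
Local Notation C := (Cplx R).
Implicit Types (z w u v : C).

Variables (p q : {poly C}) (U : set C).
Local Notation phi := (ratfun p q).
Hypothesis q0 : q != 0.
Hypothesis cpq : coprimep p q.
Hypothesis oU : open U.
Hypothesis DU : @closed_unit_disk R `<=` U.
Hypothesis qU : forall z, U z -> q.[z] != 0.
Hypothesis iU : {in U &, injective phi}.

Let Om : set C := phi @` (@unit_disk R).
Let Omc : set C := phi @` (@closed_unit_disk R).

Lemma unit_diskP z : unit_disk z <-> cmod z < 1.
Proof. by rewrite /unit_disk /= normE -cR1 lt_cR. Qed.

Lemma unit_circleP z : unit_circle z <-> cmod z = 1.
Proof.
rewrite /unit_circle /= normE -cR1; split; first exact: cR_inj.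
by move=> ->.
Qed.

Lemma closed_diskP z : closed_unit_disk z <-> cmod z <= 1.
Proof. by rewrite /closed_unit_disk /= normE -cR1 le_cR. Qed.

Lemma mem_U z : cmod z <= 1 -> U z. Proof. by move=> h; apply: DU; apply/closed_diskP. Qed.

Lemma phi_inj z w : U z -> U w -> phi z = phi w -> z = w.
Proof. by move=> Uz Uw; apply: iU; rewrite inE. Qed.

Lemma OmP w : Om w <-> exists2 z, cmod z < 1 & phi z = w.
Proof. by split=> -[z hz <-]; exists z => //; apply/unit_diskP. Qed.

Lemma OmcP w : Omc w <-> exists2 z, cmod z <= 1 & phi z = w.
Proof. by split=> -[z hz <-]; exists z => //; apply/closed_diskP. Qed.

(** Otherwise points outside [U] of modulus below [1 + 1 / n] would accumulate in the closed disk,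
    hence inside the open set [U]. *)
Lemma U_margin : exists2 e : R, 0 < e & forall z, cmod z < 1 + e -> U z.
Proof.
apply: contrapT => no.
have [v Hv] : {v : nat -> C & forall n, cmod (v n) < 1 + n.+1%:R^-1 /\ ~ U (v n)}.
  apply: (@choice _ _ (fun (n : nat) z => cmod z < 1 + n.+1%:R^-1 /\ ~ U z)) => n.
  apply: contrapT => nz; apply: no; exists n.+1%:R^-1; first by rewrite invr_gt0.
  by move=> z hz; apply: contrapT => nU; apply: nz; exists z.
have [n|z Hz] := @bolzano_weierstrassC R v 2.
  have [h _] := Hv n; apply: le_trans (ltW h) _.
  have : (n.+1%:R : R)^-1 <= 1 by rewrite invf_le1 // ler1n.
  by move: (_^-1) => x; lra.
have z1 : cmod z <= 1.
  rewrite -subr_le0; apply: (@le0_eps _ _ 2) => e e0.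
  have [N HN] := inv_small e0; have [n Nn hn] := Hz e e0 N.
  have [h _] := Hv n; have := cmod_rtri z (v n); rewrite cmodB; move: h (HN n Nn).
  by move: (n.+1%:R^-1) => x; lra.
have /openCP /(_ z (mem_U z1)) [d d0 Hd] := oU.
have [n _ hn] := Hz d d0 0%N.
by have [_ nU] := Hv n; apply: nU; exact: Hd.
Qed.

Lemma phi_nonconst v : p - v%:P * q != 0.
Proof.
apply/eqP => h.
have pv z : U z -> phi z = v.
  move=> Uz; have := congr1 (fun s : {poly C} => s.[z]) h.
  rewrite !hornerE => /eqP; rewrite subr_eq0 => /eqP pz.
  by rewrite /ratfun pz mulfK // qU.
have U0 : U 0 by apply: mem_U; rewrite cmod0 ler01.
have U1 : U 1 by apply: mem_U; rewrite cmod1.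
have := phi_inj U0 U1; rewrite !pv // => /(_ erefl) /eqP.
by rewrite eq_sym oner_eq0.
Qed.

Lemma Om_open w : Om w -> exists2 e : R, 0 < e & forall x, cmod (x - w) < e -> Om x.
Proof.
move=> /OmP[z z1 <-].
have Uz : U z by apply/mem_U/ltW.
have d0 : 0 < 1 - cmod z by rewrite subr_gt0.
have [e e0 He] := ratfun_open (qU Uz) (phi_nonconst (phi z)) d0.
exists e => // x /He [y [hy _ <-]]; apply/OmP; exists y => //.
by have := cmod_rtri y z; lra.
Qed.

Lemma Omc_closed : eclosed Omc.
Proof.
move=> w Hw.
have [v Hv] : {v : nat -> C & forall n, cmod (v n) <= 1 /\ cmod (phi (v n) - w) < n.+1%:R^-1}.
  apply: (@choice _ _ (fun (n : nat) z => cmod z <= 1 /\ cmod (phi z - w) < n.+1%:R^-1)) => n.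
  have [|x /OmcP[z z1 <-] hx] := Hw n.+1%:R^-1; first by rewrite invr_gt0.
  by exists z.
have [z Hz] := @bolzano_weierstrassC R v 1 (fun n => (Hv n).1).
have z1 : cmod z <= 1.
  rewrite -subr_le0; apply: (@le0_eps _ _ 1) => e e0; rewrite mulr1.
  have [n _ hn] := Hz e e0 0%N.
  have [h _] := Hv n; have := cmod_rtri z (v n); rewrite cmodB; lra.
apply/OmcP; exists z => //.
apply/eqP; rewrite -subr_eq0 -cmod_eq0 eq_le cmod_ge0 andbT.
apply: (@le0_eps _ _ 2) => e e0.
have [d d0 Hd] := @ccont_ratfun _ setT p q z (qU (mem_U z1)) e e0.
have [N HN] := inv_small e0; have [n Nn hn] := Hz d d0 N.
have h1 := Hd _ I hn; have [_ h2] := Hv n; have h3 := lt_trans h2 (HN n Nn).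
by have := cmod_tri (phi z) w (phi (v n)); rewrite (cmodB (phi z) (phi (v n))); lra.
Qed.

Lemma Omc_bounded : exists M : R, forall w, Omc w -> cmod w <= M.
Proof.
have D0 : [set u : C | cmod u <= 1] 0 by rewrite /= cmod0 ler01.
have [|||m m1 Hm] := @compact_max_modulus R [set u | cmod u <= 1] phi 0 D0.
- by move=> z Hz; rewrite /= -subr_le0; apply: (@le0_eps _ _ 1) => e /Hz[w /= w1 hw];
    rewrite mulr1; have := cmod_rtri z w; rewrite cmodB; lra.
- by exists 1.
- by move=> z z1; apply: ccont_ratfun; apply: qU; exact: mem_U.
by exists (cmod (phi m)) => w /OmcP[z z1 <-]; exact: Hm.
Qed.

Lemma Om_Omc w : Om w -> Omc w.
Proof. by move=> /OmP[z z1 <-]; apply/OmcP; exists z => //; exact: ltW. Qed.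

Lemma closure_Om : closure Om = Omc.
Proof.
apply/seteqP; split => w.
  move=> /closureCP H; apply: Omc_closed => e /H[x Ox hx]; exists x => //; exact: Om_Omc.
move=> /OmcP[z z1 <-]; apply/closureCP => e e0.
have [d d0 Hd] := @ccont_ratfun _ setT p q z (qU (mem_U z1)) e e0.
have [zlt|zge] := ltP (cmod z) 1.
  by exists (phi z); [apply/OmP; exists z|rewrite subrr cmod0].
have zE : cmod z = 1 by apply/eqP; rewrite eq_le z1.
pose x := Num.min (d / 2) (1 / 2).
have x0 : 0 < x by rewrite lt_min !divr_gt0.
have xd : x < d by rewrite gt_min; apply/orP; left; lra.
have x2 : x <= 1 / 2 by rewrite ge_min lexx orbT.
exists (phi (cR (1 - x) * z)).
  by apply/OmP; exists (cR (1 - x) * z) => //; rewrite cmodM zE mulr1 cmod_cR ger0_norm; lra.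
apply: Hd => //; have -> : cR (1 - x) * z - z = - cR x * z by rewrite cRD cRN cR1; ring.
by rewrite cmodM cmodN cmod_cR zE mulr1 gtr0_norm.
Qed.

Lemma phi_exterior z : U z -> 1 < cmod z -> ~ Omc (phi z).
Proof.
move=> Uz z1 /OmcP[w w1 /(phi_inj (mem_U w1) Uz) wz].
by move: z1; rewrite -wz ltNge w1.
Qed.

Lemma phi_boundary z : cmod z = 1 -> Omc (phi z) /\ ~ Om (phi z).
Proof.
move=> z1; split; first by apply/OmcP; exists z; rewrite ?z1.
move=> /OmP[w w1 h]; have := phi_inj (mem_U (ltW w1)) (mem_U _) h.
by rewrite z1 => /(_ (lexx _)) wz; move: w1; rewrite wz z1 ltxx.
Qed.

Lemma Omc_boundary w : Omc w -> ~ Om w -> exists2 t, cmod t = 1 & phi t = w.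
Proof.
move=> /OmcP[t t1 tw] nO; exists t => //.
apply/eqP; rewrite eq_le t1 leNgt; apply/negP => h; apply: nO; apply/OmP; by exists t.
Qed.

(** A boundary point [phi t] is the limit of [phi ((1 + x) * t)], which is exterior by univalence
    beyond the closed disk. *)
Lemma closure_exterior w : closure (~` closure Om) w <-> ~ Om w.
Proof.
rewrite closure_Om; split.
  move=> /closureCP H /Om_open[e e0 He]; have [x nx hx] := H e e0.
  by apply: nx; apply: Om_Omc; exact: He.
move=> nO; have [Ow|nw] := pselect (Omc w); last exact: subset_closure.
have [t t1 <-] := Omc_boundary Ow nO.
have [e1 e10 He1] := U_margin.
apply/closureCP => e e0.
have Ut : U t by apply: mem_U; rewrite t1.
have [d d0 Hd] := @ccont_ratfun _ setT p q t (qU Ut) e e0.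
pose x := Num.min d e1 / 2.
have mn : 0 < Num.min d e1 by rewrite lt_min d0.
have x0 : 0 < x by rewrite divr_gt0.
have /andP[xd xe] : (x < d) && (x < e1) by rewrite -lt_min /x ltr_pdivrMr // ltr_pMr // ltr1n.
have cmt : cmod (cR (1 + x) * t) = 1 + x by rewrite cmodM t1 mulr1 cmod_cR gtr0_norm //; lra.
exists (phi (cR (1 + x) * t)).
  by apply: phi_exterior; [apply: He1; rewrite cmt; lra|rewrite cmt; lra].
apply: Hd => //; have -> : cR (1 + x) * t - t = cR x * t by rewrite cRD cR1; ring.
by rewrite cmodM cmod_cR t1 mulr1 gtr0_norm.
Qed.

Hypothesis deg2 : (2 <= ratfun_degree p q)%N.
Local Notation n := (ratfun_degree p q).

Lemma size_p : (size p <= n.+1)%N.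
Proof. by apply: leq_trans (leqSpred _) _; rewrite ltnS leq_maxl. Qed.

Lemma size_q : (size q <= n.+1)%N.
Proof. by apply: leq_trans (leqSpred _) _; rewrite ltnS leq_maxr. Qed.

(** The Wronskian is a nonzero polynomial; with its possible zero at 0 factored out, it is nonzero
    at a small positive real point. *)
Lemma regular_point : exists2 a, cmod a < 1 & (p^`() * q - p * q^`()).[a] != 0.
Proof.
have W0 : p^`() * q - p * q^`() != 0 by apply: wronskian_neq0 => //; exact: ltnW.
have [m [T T0 WT]] := multiplicity_XsubC (p^`() * q - p * q^`()) 0; rewrite W0 /= in T0.
have [d d0 Hd] := horner_neq0_near T0.
pose x := Num.min (d / 2) (1 / 2).
have x0 : 0 < x by rewrite lt_min !divr_gt0.
have xd : x < d by rewrite gt_min; apply/orP; left; lra.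
have x2 : x <= 1 / 2 by rewrite ge_min lexx orbT.
exists (cR x); first by rewrite cmod_cR gtr0_norm //; lra.
have xn0 : cR x != 0 by rewrite -cmod_gt0 cmod_cR gtr0_norm.
rewrite WT hornerM horner_exp hornerXsubC subr0 mulf_neq0 ?expf_neq0 //.
rewrite -cmod_gt0; apply: lt_trans (Hd (cR x) _); first by rewrite divr_gt0 // cmod_gt0.
by rewrite subr0 cmod_cR gtr0_norm.
Qed.

Variables (a : C) (f g : C -> C).
Hypothesis a1 : cmod a < 1.
Hypothesis regular_a : (p^`() * q - p * q^`()).[a] != 0.
Hypothesis fOm : forall w, Om w -> derivable f w 1.
Hypothesis fcl : forall w, Omc w -> ccont Omc f w.
Hypothesis gext : forall w, ~ Omc w -> derivable g w 1.
Hypothesis gcl : forall w, ~ Om w -> ccont (~` Om) g w.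
Hypothesis ginf : holo_at_infty_zero g.
Hypothesis fg : forall w, Omc w -> ~ Om w -> f w = Num.conj (g w).

Let w0 := phi a.
Let r := p - w0%:P * q.
Let P := rev_poly n q.
Let Q := rev_poly n r.
(** [K] and [V] are the images, under [w -> 1 / (w - w0)], of the complements of [Om] and [Omc] with
    infinity added. Infinity goes to 0, which needs its own clause because [0^-1 = 0]. *)
Let K : set C := [set v | v = 0 \/ ~ Om (w0 + v^-1)].
Let V : set C := [set v | v = 0 \/ ~ Omc (w0 + v^-1)].
(** The value at 0 is the value of [g] at infinity. *)
Let k v := if v == 0 then 0 else g (w0 + v^-1).
Let F u := Num.conj (f (phi (Num.conj u))).

Lemma mem_U_a : U a. Proof. exact/mem_U/ltW/a1. Qed.

Lemma size_r : (size r <= n.+1)%N.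
Proof.
apply: leq_trans (size_polyD _ _) _; rewrite geq_max size_p size_polyN mul_polyC /=.
exact: leq_trans (size_scale_leq _ _) size_q.
Qed.

Lemma r_horner z : r.[z] = p.[z] - w0 * q.[z].
Proof. by rewrite /r !hornerE. Qed.

Lemma r_phi z : q.[z] != 0 -> r.[z] = (phi z - w0) * q.[z].
Proof. by move=> qz; rewrite r_horner mulrBl divfK. Qed.

Lemma r_root z : U z -> r.[z] = 0 -> z = a.
Proof.
move=> Uz; rewrite r_phi ?qU // => /eqP; rewrite mulf_eq0 (negPf (qU Uz)) orbF subr_eq0 => /eqP.
exact/(phi_inj Uz mem_U_a).
Qed.

Lemma chiE u : u != 0 -> q.[u^-1] != 0 -> ratfun P Q u = (phi u^-1 - w0)^-1.
Proof.
move=> u0 qu; rewrite {1}/ratfun /P /Q !rev_poly_horner ?size_q ?size_r //.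
rewrite r_phi //; have un : u ^+ n != 0 by rewrite expf_neq0.
rewrite invfM mulrACA divff // mul1r invfM mulrCA divff // mulr1 //.
Qed.

(** At [z = 0] both values are coefficients of degree [n]; they cannot vanish together because [n]
    is the larger of the degrees of [p] and [q]. Elsewhere this is the coprimality of [p] and [q] at
    [1 / z]. *)
Lemma PQ_coprime z : Q.[z] = 0 -> P.[z] != 0.
Proof.
have [->|z0] := eqVneq z 0.
  rewrite /P /Q !rev_poly0 => rn; apply/eqP => qn.
  have pn : p`_n = 0.
    by move: rn; rewrite /r coefB mul_polyC coefZ qn mulr0 subr0.
  have n0 : (0 < n)%N by exact: ltnW deg2.
  have : (n == (size p).-1) || (n == (size q).-1).
    by rewrite /ratfun_degree /maxn; case: ltnP; rewrite eqxx ?orbT.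
  move=> /orP[/eqP nE|/eqP nE].
    have p00 : p != 0 by apply/eqP => p00; move: n0; rewrite nE p00 size_poly0.
    by move: pn; rewrite nE -/(lead_coef p) => /eqP; rewrite lead_coef_eq0 (negPf p00).
  by move: qn; rewrite nE -/(lead_coef q) => /eqP; rewrite lead_coef_eq0 (negPf q0).
rewrite /P /Q !rev_poly_horner ?size_q ?size_r // => /eqP.
have zn : z ^+ n != 0 by rewrite expf_neq0.
rewrite mulf_eq0 (negPf zn) /= => /eqP rz; rewrite mulf_neq0 //; apply/eqP => qz.
move: rz; rewrite r_horner qz mulr0 subr0 => pz.
have := coprimep_root cpq; move=> /(_ z^-1); rewrite /root pz eqxx => /(_ isT).
by rewrite qz eqxx.
Qed.

Lemma w0Om : Om w0. Proof. by apply/OmP; exists a. Qed.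

Lemma Om_near_K v : v != 0 -> Om (w0 + v^-1) ->
  exists2 e : R, 0 < e & forall x, cmod (x - v) < e -> Om (w0 + x^-1).
Proof.
move=> v0 /Om_open[e e0 He].
have [d d0 Hd] := @inv_ccont R setT w0 v v0 e e0.
by exists d => // x /(Hd x I) h; exact: He.
Qed.

Lemma neq0_near v x : cmod (x - v) < cmod v -> x != 0.
Proof.
by move=> h; apply/eqP => x0; move: h; rewrite x0 sub0r cmodN ltxx.
Qed.

Lemma K_closed : eclosed K.
Proof.
move=> v Hv; have [->|v0] := eqVneq v 0; first by left.
right => Ov; have [e e0 He] := Om_near_K v0 Ov.
have [|x Kx] := Hv (Num.min e (cmod v)); first by rewrite lt_min e0 cmod_gt0.
rewrite lt_min => /andP[/He Ox /neq0_near x0].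
by case: Kx => [xE|//]; rewrite xE eqxx in x0.
Qed.

Lemma K_bounded : ebounded K.
Proof.
have [e e0 He] := Om_open w0Om.
exists e^-1 => v [->|nO]; first by rewrite cmod0 invr_ge0 ltW.
have [->|v0] := eqVneq v 0; first by rewrite cmod0 invr_ge0 ltW.
rewrite leNgt; apply/negP => h; apply: nO; apply: He.
by rewrite addrC addKr cmodV invf_plt ?posrE // cmod_gt0.
Qed.

Lemma V_open : eopen V.
Proof.
move=> v Vv; have [vE|v0] := eqVneq v 0.
  (* Since [Omc] is bounded, [w0 + x^-1] is exterior for every small nonzero [x]. *)
  have [M HM] := Omc_bounded.
  have M0 : 0 < `|M| + cmod w0 + 1 by have := cmod_ge0 w0; have := normr_ge0 M; lra.
  exists (`|M| + cmod w0 + 1)^-1; first by rewrite invr_gt0.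
  move=> x; rewrite vE subr0 => hx; have [->|x0] := eqVneq x 0; first by left.
  right => /HM h.
  have : `|M| + cmod w0 + 1 < cmod x^-1 by rewrite cmodV invf_pgt ?posrE ?cmod_gt0.
  have := cmod_rtri x^-1 (- w0); rewrite opprK cmodN [x^-1 + _]addrC.
  by have := ler_norm M; lra.
case: Vv => [vE|nO]; first by rewrite vE eqxx in v0.
have [e e0 He] : exists2 e : R, 0 < e & forall y, cmod (y - (w0 + v^-1)) < e -> ~ Omc y.
  apply: contrapT => no; apply: nO; apply: Omc_closed => e e0.
  apply: contrapT => no'; apply: no; exists e => // y hy Oy; apply: no'.
  by exists y.
have [d d0 Hd] := @inv_ccont R setT w0 v v0 e e0.
exists d => // x /(Hd x I) h; right; exact: He.
Qed.

Lemma V_sub_K : V `<=` K.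
Proof. by move=> v [->|nO]; [left|right => /Om_Omc]. Qed.

Lemma k_der v : V v -> derivable k v 1.
Proof.
move=> Vv; have [vE|v0] := eqVneq v 0.
  (* Near 0, [w0 + 1 / x] is the inverse of [x / (1 + w0 * x)], so [k] is [G], derivable at 0 by the
     condition at infinity, composed with this map. The radius below keeps [1 + w0 * x] away from
     0. *)
  rewrite vE; pose G w := if w == 0 then 0 else g w^-1.
  have c1 : 0 < cmod w0 + 1 by have := cmod_ge0 w0; lra.
  apply: (@derC_near _ (fun x => G (x / (1 + w0 * x))) k 0 (cmod w0 + 1)^-1).
  - by rewrite invr_gt0.
  - move=> x; rewrite subr0 => hx; rewrite /G /k.
    have x1 : 1 + w0 * x != 0.
      rewrite -cmod_gt0; have := cmod_rtri 1 (- (w0 * x)); rewrite opprK cmodN cmod1 cmodM.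
      have : (cmod w0 + 1) * cmod x < 1 by rewrite mulrC -ltr_pdivlMr // mul1r.
      have := cmod_ge0 x; nra.
    rewrite mulf_eq0 invr_eq0 (negPf x1) orbF; case: eqVneq => // x0.
    by rewrite invfM invrK mulrDr mulr1 mulrCA mulVf // mulr1 addrC.
  - have d1 : derivable (fun x : C => x / (1 + w0 * x)) 0 1.
      apply: (@derC_div _ (fun x => x) (fun x => 1 + w0 * x) 0 _ (@derC_id _ 0)).
        by rewrite mulr0 addr0 oner_eq0.
      exact: (@derC_add _ (fun _ => 1) (fun x => w0 * x) 0 (@derC_cst _ 1 0)
        (@derC_mul _ (fun _ => w0) (fun x => x) 0 (@derC_cst _ w0 0) (@derC_id _ 0))).
    apply: (@derivable_compC _ (fun x => x / (1 + w0 * x)) G 0 d1).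
    by rewrite mul0r; exact: ginf.
have nO : ~ Omc (w0 + v^-1) by case: Vv => [vE|//]; rewrite vE eqxx in v0.
apply: (@derC_near _ (fun x => g (w0 + x^-1)) k v (cmod v)); first by rewrite cmod_gt0.
  by move=> x /neq0_near x0; rewrite /k (negPf x0).
apply: (@derivable_compC _ (fun x => w0 + x^-1) g v _ (gext nO)).
exact: (@derC_add _ (fun _ => w0) (fun x => x^-1) v (@derC_cst _ w0 v)
  (@derC_inv _ (fun x => x) v v0 (@derC_id _ v))).
Qed.

Lemma k_cont v : K v -> ccont K k v.
Proof.
move=> Kv; have [/k_der h|nV] := pselect (V v); first exact: derivable_ccont.
have v0 : v != 0 by apply/eqP => v0; apply: nV; left.
have nO : ~ Om (w0 + v^-1) by case: Kv => [vE|//]; rewrite vE eqxx in v0.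
move=> e e0; have [d d0 Hd] := gcl nO e0.
have [d' d'0 Hd'] := @inv_ccont R setT w0 v v0 d d0.
exists (Num.min d' (cmod v)); first by rewrite lt_min d'0 cmod_gt0.
move=> x Kx; rewrite lt_min => /andP[xd /neq0_near x0].
rewrite /k (negPf x0) (negPf v0); apply: Hd; last exact: Hd'.
by case: Kx => [xE|//]; rewrite xE eqxx in x0.
Qed.

Lemma F_cont u : cmod u <= 1 -> ccont [set u | cmod u <= 1] F u.
Proof.
move=> u1.
have cu1 : cmod (Num.conj u) <= 1 by rewrite cmod_conj.
have Ou : Omc (phi (Num.conj u)) by apply/OmcP; exists (Num.conj u).
move=> e e0; have [d d0 Hd] := fcl Ou e0.
have [d' d'0 Hd'] := @ccont_ratfun _ setT p q _ (qU (mem_U cu1)) d d0.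
exists d' => // x x1 hx; rewrite /F -rmorphB cmod_conj; apply: Hd.
  by apply/OmcP; exists (Num.conj x) => //; rewrite cmod_conj.
by apply: Hd' => //; rewrite -rmorphB cmod_conj.
Qed.

Lemma F_der u : cmod u < 1 -> derivable F u 1.
Proof.
move=> u1; have cu1 : cmod (Num.conj u) < 1 by rewrite cmod_conj.
apply: (@derC_conj _ (fun x => f (phi x)) u).
apply: (@derivable_compC _ phi f (Num.conj u)).
  by apply: derC_ratfun; apply: qU; exact: mem_U (ltW cu1).
by apply: fOm; apply/OmP; exists (Num.conj u).
Qed.

Lemma chi_unwind u : u != 0 -> U u^-1 -> phi u^-1 != w0 ->
  ratfun P Q u != 0 /\ w0 + (ratfun P Q u)^-1 = phi u^-1.
Proof.
move=> u0 Uu ne; rewrite chiE ?qU // invrK [w0 + _]addrC subrK; split => //.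
by rewrite invr_eq0 subr_eq0.
Qed.

Lemma phi_neq_w0 z : U z -> 1 <= cmod z -> phi z != w0.
Proof.
move=> Uz z1; apply/eqP => /(phi_inj Uz mem_U_a) za.
by move: a1; rewrite -za ltNge z1.
Qed.

(** The point [a] is a simple root of [r], whose formal degree is [n >= 2]. Any other root lies
    outside the closed disk by univalence, and its inverse is a root of [Q] inside. *)
Lemma pole_in_disk : exists2 u, cmod u < 1 & Q.[u] = 0.
Proof.
have ra : r.[a] = 0 by rewrite r_phi ?qU ?subrr ?mul0r //; exact: mem_U_a.
(* Since [w0 = p.[a] / q.[a]], the product of this derivative with [q.[a]] is the Wronskian at
   [a]. *)
have r'a : r^`().[a] != 0.
  have qa := qU mem_U_a; apply: contra regular_a => /eqP h.
  have : r^`().[a] * q.[a] = 0 by rewrite h mul0r.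
  rewrite /r derivB derivM derivC mul0r add0r !hornerE /w0 /ratfun mulrBl => h'.
  rewrite -h'; apply/eqP; congr (_ - _).
  by rewrite mulrAC divfK.
(* A drop of degree means that [phi] takes the value [w0] at infinity; the pole is then [u = 0]. *)
have [rn|rn] := eqVneq r`_n 0.
  by exists 0; [rewrite cmod0|rewrite /Q rev_poly0].
have sr : size r = n.+1.
  by apply/eqP; rewrite eqn_leq size_r ltnNge; apply: contra rn => h; rewrite nth_default.
have /factor_theorem [s rs] : root r a by rewrite /root ra.
have s0 : s != 0 by apply/eqP => s0; move: rn; rewrite rs s0 mul0r coef0 eqxx.
have ss : size s = n.
  by move: sr; rewrite rs size_Mmonic ?monicXsubC // size_XsubC addn2 => -[].
have [x] : exists x, root s x.
  by apply/closed_rootP; rewrite ss neq_ltn deg2 orbT.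
rewrite /root => /eqP sx.
have sa : s.[a] != 0.
  apply: contra r'a => /eqP sa.
  by rewrite rs derivM derivXsubC mulr1 hornerD hornerM hornerXsubC subrr mulr0 add0r sa.
have xa : x != a by apply: contraNneq sa => <-; rewrite sx.
have rx : r.[x] = 0 by rewrite rs hornerM sx mul0r.
have x1 : 1 < cmod x.
  by rewrite ltNge; apply/negP => /mem_U Ux; move: xa; rewrite (r_root Ux rx) eqxx.
have x0 : x != 0 by rewrite -cmod_gt0; exact: lt_trans x1.
exists x^-1; first by rewrite cmodV invf_lt1 // cmod_gt0.
by rewrite /Q rev_poly_horner ?size_r ?invr_eq0 // invrK rx mulr0.
Qed.

Lemma matching_trivial : (forall w, Omc w -> f w = 0) /\ (forall w, ~ Om w -> g w = 0).
Proof.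
have [e e0 He] := U_margin.
have ep : 0 < 1 + e by lra.
(* Inversion sends the collar [rho < cmod u < 1] into the margin where [phi] is still univalent. *)
pose rho := (1 + e)^-1.
have rho0 : 0 < rho by rewrite invr_gt0.
have rho1 : rho < 1 by rewrite invf_lt1 //; lra.
have nz u : rho < cmod u -> u != 0 by move=> h; rewrite -cmod_gt0; exact: lt_trans h.
have Uinv u : rho < cmod u -> U u^-1.
  move=> h; apply: He; rewrite cmodV invf_plt ?posrE //; exact: lt_trans h.
have inv1 u : rho < cmod u -> cmod u <= 1 -> 1 <= cmod u^-1.
  by move=> h h1; rewrite cmodV invf_ge1 //; exact: lt_trans h.
have circ u : cmod u = 1 -> [/\ u != 0, U u^-1, 1 <= cmod u^-1 & cmod u^-1 = 1].
  move=> u1; have hu : rho < cmod u by rewrite u1.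
  by split; [exact: nz|exact: Uinv|apply: inv1; rewrite ?u1|rewrite cmodV u1 invr1].
have kcirc u : cmod u = 1 -> F u = k (ratfun P Q u).
  move=> u1; have [un Uu u1' uE] := circ u u1.
  have [c0 cE] := chi_unwind un Uu (phi_neq_w0 Uu u1').
  rewrite /k (negPf c0) cE /F.
  have -> : Num.conj u = u^-1.
    by apply: (mulfI un); rewrite -normCK normE u1 expr1n divff.
  by have [h1 h2] := phi_boundary uE; rewrite fg // conjCK.
have circK v : K v -> ~ V v -> exists2 t, cmod t = 1 & ratfun P Q t = v.
  move=> Kv nV; have v0 : v != 0 by apply/eqP => v0; apply: nV; left.
  have nO : ~ Om (w0 + v^-1) by case: Kv => [vE|//]; rewrite vE eqxx in v0.
  have Oc : Omc (w0 + v^-1) by apply: contrapT => h; apply: nV; right.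
  have [t t1 tE] := Omc_boundary Oc nO.
  have t0 : t != 0 by rewrite -cmod_gt0 t1.
  exists t^-1; first by rewrite cmodV t1 invr1.
  have Ut : U t by apply: mem_U; rewrite t1.
  by rewrite chiE ?invr_eq0 ?invrK ?qU // tE addrC addKr invrK.
have [c Hc] : exists c, forall u, cmod u <= 1 -> F u = c.
  apply: (@matching_const R P Q K V k F rho PQ_coprime K_closed K_bounded V_sub_K V_open k_cont
    k_der F_cont F_der rho0 rho1 _ _ _ circK _ _ kcirc pole_in_disk).
  - move=> u h h1; apply/eqP => Qu.
    have u0 := nz u h; have Uu := Uinv u h.
    move: Qu; rewrite /Q rev_poly_horner ?size_r // => /eqP.
    rewrite mulf_eq0 expf_eq0 (negPf u0) andbF /= => /eqP /(r_root Uu) ua.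
    by move: a1; rewrite -ua ltNge inv1.
  - move=> u h h1; have [c0 cE] := chi_unwind (nz u h) (Uinv u h)
      (phi_neq_w0 (Uinv u h) (inv1 u h (ltW h1))).
    right; rewrite cE; apply: phi_exterior; first exact: Uinv.
    by rewrite cmodV invf_gt1 //; exact: lt_trans h.
  - move=> u u1; have [un Uu u1' uE] := circ u u1.
    have [c0 cE] := chi_unwind un Uu (phi_neq_w0 Uu u1').
    have [h1 h2] := phi_boundary uE.
    split; first by right; rewrite cE.
    by move=> [c00|]; [rewrite c00 eqxx in c0|rewrite cE].
  - move=> u w hu hu1 hw hw1 E.
    have [_ cu] := chi_unwind (nz u hu) (Uinv u hu) (phi_neq_w0 (Uinv u hu) (inv1 u hu (ltW hu1))).
    have [_ cw] := chi_unwind (nz w hw) (Uinv w hw) (phi_neq_w0 (Uinv w hw) (inv1 w hw (ltW hw1))).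
    apply: invr_inj; apply: phi_inj; [exact: Uinv|exact: Uinv|].
    by rewrite -cu -cw E.
  - move=> u u1 Qu.
    have u0 : u != 0 by rewrite -cmod_gt0; exact: lt_le_trans u1.
    have ui : cmod u^-1 <= 1 by rewrite cmodV invf_le1 // cmod_gt0.
    have Uu := mem_U ui.
    have ne : phi u^-1 != w0.
      apply: contra Qu => /eqP h; rewrite /Q rev_poly_horner ?size_r // r_phi ?qU //.
      by rewrite h subrr mul0r mulr0.
    have [c0 cE] := chi_unwind u0 Uu ne.
    move=> [c00|]; first by rewrite c00 eqxx in c0.
    by rewrite cE; apply; apply/OmcP; exists u^-1.
(* [k - c] vanishes on [K] outside [V], where every point is [chi t] with [t] on the circle; the
   maximum principle extends this to all of [K]. *)
have kc v : K v -> k v = c.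
  move=> Kv; apply/eqP; rewrite -subr_eq0 -cmod_eq0 eq_le cmod_ge0 andbT.
  apply: (@max_principle R K V (fun v => k v - c) 0 K_closed K_bounded V_sub_K V_open _ _ _ v Kv).
  - move=> x Kx; apply: ccont_sub; first exact: k_cont.
    by move=> e' e'0; exists 1 => // y _ _; rewrite subrr cmod0.
  - move=> x Vx; exact: (@derC_sub _ k (fun _ => c) x (k_der Vx) (@derC_cst _ c x)).
  - move=> x Kx /(circK x Kx)[t t1 <-].
    by rewrite -kcirc // Hc ?t1 // subrr cmod0.
have c0 : c = 0 by rewrite -(kc 0) /k ?eqxx //; left.
split=> w.
  move=> /OmcP[z z1 <-].
  have := Hc (Num.conj z); rewrite cmod_conj => /(_ z1).
  by rewrite /F conjCK c0 => /(congr1 Num.conj); rewrite conjCK rmorph0.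
move=> nO; have ww : w - w0 != 0.
  by rewrite subr_eq0; apply/eqP => wE; apply: nO; rewrite wE; exact: w0Om.
have wE : w0 + (w - w0) = w by rewrite addrC subrK.
have := kc (w - w0)^-1; rewrite /k invr_eq0 (negPf ww) invrK wE c0; apply.
by right; rewrite invrK wE.
Qed.

End Domain.

(** * The theorem, with the closures identified *)

Theorem theorem3p19 (R : realType) (p q : {poly Cplx R}) (f g : Cplx R -> Cplx R) :
  R_domain_data p q ->
  (2 <= ratfun_degree p q)%N ->
  matching_solution (ratfun p q @` (@unit_disk R)) (ratfun p q @` (@unit_circle R)) f g ->
  (forall z, closure (ratfun p q @` (@unit_disk R)) z -> f z = 0) /\
  (forall z, closure (~` closure (ratfun p q @` (@unit_disk R))) z -> g z = 0).
Proof.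
move=> [q0 cpq [U [oU DU qU iU]]] deg2 [[df cf] dg cg ginf fg].
have clE : closure (ratfun p q @` @unit_disk R) = ratfun p q @` @closed_unit_disk R.
  by apply: (@closure_Om R p q U).
have exE w :
    closure (~` closure (ratfun p q @` @unit_disk R)) w <-> ~ (ratfun p q @` @unit_disk R) w.
  by apply: (@closure_exterior R p q U).
have [a a1 ra] := regular_point q0 cpq deg2.
have exS : closure (~` closure (ratfun p q @` @unit_disk R)) = ~` (ratfun p q @` @unit_disk R).
  by apply/seteqP; split => w /exE.
have [||||||f0 g0] := @matching_trivial R p q U q0 cpq oU DU qU iU deg2 a f g a1 ra.
- exact: df.
- rewrite -clE; exact: (within_ccont cf).
- rewrite -clE; exact: dg.
- rewrite -exS => w /exE; exact: (within_ccont cg).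
- exact: ginf.
- move=> w Ow nO; have [t t1 <-] := Omc_boundary Ow nO.
  by apply: fg; exists t => //; apply/unit_circleP.
by split => z; [rewrite clE; exact: f0|move=> /exE; exact: g0].
Qed.
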